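(* For every integer $n \geq 71$, $$\left(\Delta p(n)\right)^2>\Delta p(n-1)\,\Delta p(n+1),$$ where $p(n)$ is the number of partitions of $n$ and $\Delta p(n)=p(n+1)-p(n)$.
   Context: A partition of a positive integer $n$ is a non-increasing sequence of positive integers $\lambda=(\lambda_1,\ldots,\lambda_\ell)$ with $\sum_{i=1}^{\ell}\lambda_i=n$; $p(n)$ denotes the number of partitions of $n$. The first-order forward difference of a sequence $f(n)$ is $\Delta f(n)=f(n+1)-f(n)$. *)

(* Defs.v *)
From mathcomp Require Import all_boot all_order all_algebra.
Set Implicit Arguments.
Unset Strict Implicit.
Unset Printing Implicit Defensive.

Definition is_partition (n : nat) (s : seq nat) : bool :=
  [&& sorted geq s, all (leq 1) s & sumn s == n].

(* A partition of n has at most n parts, each at most n, so partitions are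
   counted in the finite type of sequences of length <= n over {0, ..., n};
   npartitions_spec shows that none is lost by these bounds. *)
Definition npartitions (n : nat) : nat :=
  #|[set s : n.-bseq 'I_n.+1 | is_partition n (map val s)]|.

Local Open Scope ring_scope.

(* Integer-valued, since subtraction on nat is truncated. *)
Definition pZ (n : nat) : int := (npartitions n)%:Z.

Definition fdiff (f : nat -> int) (n : nat) : int := f n.+1 - f n.

Local Close Scope ring_scope.

Lemma is_partition_bounds n s :
  is_partition n s -> size s <= n /\ all (geq n) s.
Proof.
case/and3P=> _ + /eqP<-; elim: s => //= x s IHs /andP[x_gt0 /IHs[szs les]].
split; first by rewrite -add1n leq_add.
rewrite leq_addr /=; apply: sub_all les => y /= ley.
exact: leq_trans ley (leq_addl _ _).
Qed.

Lemma npartitions_spec n :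
  exists2 L : seq (seq nat), uniq L & L =i is_partition n /\
    size L = npartitions n.
Proof.
pose A := [set s : n.-bseq 'I_n.+1 | is_partition n (map val s)].
exists [seq map val (bseqval s) | s <- enum A].
  rewrite map_inj_uniq ?enum_uniq // => s t /(inj_map val_inj).
  exact: val_inj.
split; last by rewrite size_map -cardE.
move=> s; rewrite -[RHS]/(is_partition n s); apply/mapP/idP => [[t]|ps].
  by rewrite mem_enum inE => pt ->.
have [szs /allP les] := is_partition_bounds ps.
have valK : map val (map (@inord n) s) = s.
  rewrite -map_comp -[RHS]map_id; apply/eq_in_map => x /les /= lex.
  by rewrite inordK.
have szs' : size (map (@inord n) s) <= n by rewrite size_map.
exists (Bseq szs'); last by rewrite /= valK.
by rewrite mem_enum inE /= valK.
Qed.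

(* Main.v *)
Require Import Defs.
From Stdlib Require Import Reals Ranalysis5 Lra Lia ZArith NArith Arith List.
From Coquelicot Require Import Coquelicot.

(* Let [q n] be the number of partitions of [n] into parts at least [2], so that
   [Delta p (n) = q (n + 1)].  By AM-GM, [q (n - 1) q (n + 1) < q n ^ 2] follows as soon as
   [q (n - 1) / x + x q (n + 1) < 2 q n] for a single [x > 0], and the coefficient formula on the
   circle of radius [x = exp (- t)] turns this into the positivity of the one real integral
     [int_0^pi Re (F (x e^(i th)) e^(- i n th)) (1 - cos th) d th],
   where [F (z) = prod_(k >= 2) (1 - z ^ k)^(-1)].  For [x] the saddle point,
   [n = sum_k k x ^ k / (1 - x ^ k)], the phase of the integrand is [O (th ^ 3 / t ^ 4)] and its
   modulus is bounded in closed form, so the integrand is positive for [|th| <= 1.6 t ^ (3/2)]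
   and that part outweighs the rest of the circle once [t <= 1 / 32], that is, once [n >= 1690].
   The product is truncated at a large [N], and the smaller [n] are checked by computation. *)

Local Open Scope R_scope.

(** * Elementary inequalities *)

(** AM-GM makes the problem linear: precise asymptotics of three consecutive coefficients are
    replaced by the sign of one integral. The factor [1 - cos th] vanishes at the centre, so the
    positive mass sits at angles of order [t ^ (3/2)] and the margin is modest: in units of
    [t ^ (9/2)] the central part contributes at least 0.084, against losses of 0.0688 on the middle
    arc and at most 0.005 beyond. The constants must therefore be nearly sharp. Their common source
    is [33 / 20], just above [zeta (2)]: the first three cumulants of the tilted distribution are at
    most 1, 2 and 6.2 times [33 / 20], over [t ^ 2], [t ^ 3] and [t ^ 4]. The threshold has the same
    origin: [n t ^ 2 <= 33 / 20] and [n >= 1690] force [t <= 1 / 32]. Everything stays real and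
    finite. Each factor of the product enters through the logarithm of its modulus and its argument,
    and coefficients are extracted by a recursion on the list of parts. Truncation avoids infinite
    products, at the price that the saddle point depends on [N], so [N] must be chosen before it. *)

Lemma le_of_derive_nonneg (f f' : R -> R) (a b : R) :
  a <= b -> (forall x, a <= x <= b -> is_derive f x (f' x)) ->
  (forall x, a <= x <= b -> 0 <= f' x) -> f a <= f b.
Proof.
intros Hab Hd Hpos.
destruct (MVT_gen f a b f') as [c [Hc Heq]].
- intros x Hx. apply Hd. rewrite Rmin_left, Rmax_right in Hx by lra. lra.
- intros x Hx. rewrite Rmin_left, Rmax_right in Hx by lra.
  apply continuity_pt_filterlim. apply (ex_derive_continuous f).
  exists (f' x). now apply Hd.
- rewrite Rmin_left, Rmax_right in Hc by lra.
  specialize (Hpos c Hc). assert (0 <= f' c * (b - a)) by (apply Rmult_le_pos; lra). lra.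
Qed.

(** This and the following Taylor bounds come from repeated integration from 0: the derivative of
    each difference is the difference treated just before. *)
Lemma sin_le_id (u : R) : 0 <= u -> sin u <= u.
Proof.
intros Hu.
assert (H := le_of_derive_nonneg (fun x => x - sin x) (fun x => 1 - cos x) 0 u Hu).
cbv beta in H. rewrite sin_0 in H.
assert (0 - 0 <= u - sin u); [apply H | lra].
- intros x _. auto_derive; [trivial | ring].
- intros x _. pose proof (COS_bound x); lra.
Qed.

Lemma one_sub_cos_le_half_sqr (u : R) : 1 - cos u <= u ^ 2 / 2.
Proof.
assert (Hp : forall v, 0 <= v -> 1 - cos v <= v ^ 2 / 2).
{ intros v Hv.
  assert (H := le_of_derive_nonneg (fun x => x ^ 2 / 2 + cos x) (fun x => x - sin x) 0 v Hv).
  cbv beta in H. rewrite cos_0 in H.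
  assert (0 ^ 2 / 2 + 1 <= v ^ 2 / 2 + cos v); [apply H | lra].
  - intros x _. auto_derive; [trivial | field].
  - intros x Hx. pose proof (sin_le_id x (proj1 Hx)); lra. }
destruct (Rle_dec 0 u) as [Hu | Hu]; [now apply Hp |].
specialize (Hp (- u)). rewrite cos_neg in Hp. replace ((- u) ^ 2) with (u ^ 2) in Hp by ring.
apply Hp; lra.
Qed.

Lemma sin_ge_cubic (u : R) : 0 <= u -> u - u ^ 3 / 6 <= sin u.
Proof.
intros Hu.
assert (H := le_of_derive_nonneg (fun x => sin x - x + x ^ 3 / 6)
  (fun x => cos x - 1 + x ^ 2 / 2) 0 u Hu).
cbv beta in H. rewrite sin_0 in H.
assert (0 - 0 + 0 ^ 3 / 6 <= sin u - u + u ^ 3 / 6); [apply H | lra].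
- intros x _. auto_derive; [trivial | field].
- intros x _. pose proof (one_sub_cos_le_half_sqr x); lra.
Qed.

Lemma one_sub_cos_ge_quartic (u : R) : 0 <= u -> u ^ 2 / 2 - u ^ 4 / 24 <= 1 - cos u.
Proof.
intros Hu.
assert (H := le_of_derive_nonneg (fun x => - cos x - x ^ 2 / 2 + x ^ 4 / 24)
  (fun x => sin x - x + x ^ 3 / 6) 0 u Hu).
cbv beta in H. rewrite cos_0 in H.
assert (- (1) - 0 ^ 2 / 2 + 0 ^ 4 / 24 <= - cos u - u ^ 2 / 2 + u ^ 4 / 24); [apply H | lra].
- intros x _. auto_derive; [trivial | field].
- intros x Hx. pose proof (sin_ge_cubic x (proj1 Hx)); lra.
Qed.

Lemma exp_ge_cubic (u : R) : 0 <= u -> 1 + u + u ^ 2 / 2 + u ^ 3 / 6 <= exp u.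
Proof.
assert (H1 : forall v, 0 <= v -> 1 + v + v ^ 2 / 2 <= exp v).
{ intros v Hv.
  assert (H := le_of_derive_nonneg (fun x => exp x - (1 + x + x ^ 2 / 2))
    (fun x => exp x - (1 + x)) 0 v Hv).
  cbv beta in H. rewrite exp_0 in H.
  assert (1 - (1 + 0 + 0 ^ 2 / 2) <= exp v - (1 + v + v ^ 2 / 2)); [apply H | lra].
  - intros x _. auto_derive; [trivial | field].
  - intros x _. pose proof (exp_ineq1_le x); lra. }
intros Hu.
assert (H := le_of_derive_nonneg (fun x => exp x - (1 + x + x ^ 2 / 2 + x ^ 3 / 6))
    (fun x => exp x - (1 + x + x ^ 2 / 2)) 0 u Hu).
cbv beta in H. rewrite exp_0 in H.
assert (1 - (1 + 0 + 0 ^ 2 / 2 + 0 ^ 3 / 6) <= exp u - (1 + u + u ^ 2 / 2 + u ^ 3 / 6));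
  [apply H | lra].
- intros x _. auto_derive; [trivial | field].
- intros x Hx. pose proof (H1 x (proj1 Hx)); lra.
Qed.

Lemma exp_opp_ge_cubic (u : R) : 0 <= u -> 1 - u + u ^ 2 / 2 - u ^ 3 / 6 <= exp (- u).
Proof.
assert (H1 : forall v, 0 <= v -> exp (- v) <= 1 - v + v ^ 2 / 2).
{ intros v Hv.
  assert (H := le_of_derive_nonneg (fun x => (1 - x + x ^ 2 / 2) - exp (- x))
    (fun x => exp (- x) - (1 - x)) 0 v Hv).
  cbv beta in H. rewrite Ropp_0, exp_0 in H.
  assert ((1 - 0 + 0 ^ 2 / 2) - 1 <= (1 - v + v ^ 2 / 2) - exp (- v)); [apply H | lra].
  - intros x _. auto_derive; [trivial | field].
  - intros x _. pose proof (exp_ineq1_le (- x)); lra. }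
intros Hu.
assert (H := le_of_derive_nonneg (fun x => exp (- x) - (1 - x + x ^ 2 / 2 - x ^ 3 / 6))
    (fun x => (1 - x + x ^ 2 / 2) - exp (- x)) 0 u Hu).
cbv beta in H. rewrite Ropp_0, exp_0 in H.
assert (1 - (1 - 0 + 0 ^ 2 / 2 - 0 ^ 3 / 6) <= exp (- u) - (1 - u + u ^ 2 / 2 - u ^ 3 / 6));
  [apply H | lra].
- intros x _. auto_derive; [trivial | field].
- intros x Hx. pose proof (H1 x (proj1 Hx)); lra.
Qed.

(* [exp s + exp (- s) - 2 = 4 sinh (s / 2) ^ 2] *)
Definition dcosh (s : R) : R := exp s + exp (- s) - 2.

(** Repeated integration alternates between [sinh] and [cosh]. The sixth-degree term is kept for
    [polylog3_le], where it controls large [s]. *)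
Lemma dcosh_ge (s : R) : 0 <= s -> s ^ 2 + s ^ 4 / 12 + s ^ 6 / 360 <= dcosh s.
Proof.
assert (H2 : forall v, 0 <= v -> 2 * v <= exp v - exp (- v)).
{ intros v Hv.
  assert (H := le_of_derive_nonneg (fun x => exp x - exp (- x) - 2 * x)
    (fun x => exp x + exp (- x) - 2) 0 v Hv).
  cbv beta in H. rewrite Ropp_0, exp_0 in H.
  assert (1 - 1 - 2 * 0 <= exp v - exp (- v) - 2 * v); [apply H | lra].
  - intros x _. auto_derive; [trivial | field].
  - intros x _. pose proof (exp_ineq1_le (- x)); pose proof (exp_ineq1_le x); lra. }
assert (H3 : forall v, 0 <= v -> 2 + v ^ 2 <= exp v + exp (- v)).
{ intros v Hv.
  assert (H := le_of_derive_nonneg (fun x => exp x + exp (- x) - (2 + x ^ 2))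
    (fun x => exp x - exp (- x) - 2 * x) 0 v Hv).
  cbv beta in H. rewrite Ropp_0, exp_0 in H.
  assert (1 + 1 - (2 + 0 ^ 2) <= exp v + exp (- v) - (2 + v ^ 2)); [apply H | lra].
  - intros x _. auto_derive; [trivial | field].
  - intros x Hx. pose proof (H2 x (proj1 Hx)); lra. }
assert (H4 : forall v, 0 <= v -> 2 * v + v ^ 3 / 3 <= exp v - exp (- v)).
{ intros v Hv.
  assert (H := le_of_derive_nonneg (fun x => exp x - exp (- x) - (2 * x + x ^ 3 / 3))
    (fun x => exp x + exp (- x) - (2 + x ^ 2)) 0 v Hv).
  cbv beta in H. rewrite Ropp_0, exp_0 in H.
  assert (1 - 1 - (2 * 0 + 0 ^ 3 / 3) <= exp v - exp (- v) - (2 * v + v ^ 3 / 3));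
    [apply H | lra].
  - intros x _. auto_derive; [trivial | field].
  - intros x Hx. pose proof (H3 x (proj1 Hx)); lra. }
assert (H5 : forall v, 0 <= v -> 2 + v ^ 2 + v ^ 4 / 12 <= exp v + exp (- v)).
{ intros v Hv.
  assert (H := le_of_derive_nonneg (fun x => exp x + exp (- x) - (2 + x ^ 2 + x ^ 4 / 12))
    (fun x => exp x - exp (- x) - (2 * x + x ^ 3 / 3)) 0 v Hv).
  cbv beta in H. rewrite Ropp_0, exp_0 in H.
  assert (1 + 1 - (2 + 0 ^ 2 + 0 ^ 4 / 12) <= exp v + exp (- v) - (2 + v ^ 2 + v ^ 4 / 12));
    [apply H | lra].
  - intros x _. auto_derive; [trivial | field].
  - intros x Hx. pose proof (H4 x (proj1 Hx)); lra. }
assert (H6 : forall v, 0 <= v -> 2 * v + v ^ 3 / 3 + v ^ 5 / 60 <= exp v - exp (- v)).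
{ intros v Hv.
  assert (H := le_of_derive_nonneg
    (fun x => exp x - exp (- x) - (2 * x + x ^ 3 / 3 + x ^ 5 / 60))
    (fun x => exp x + exp (- x) - (2 + x ^ 2 + x ^ 4 / 12)) 0 v Hv).
  cbv beta in H. rewrite Ropp_0, exp_0 in H.
  assert (1 - 1 - (2 * 0 + 0 ^ 3 / 3 + 0 ^ 5 / 60)
          <= exp v - exp (- v) - (2 * v + v ^ 3 / 3 + v ^ 5 / 60)); [apply H | lra].
  - intros x _. auto_derive; [trivial | field].
  - intros x Hx. pose proof (H5 x (proj1 Hx)); lra. }
intros Hs. unfold dcosh.
assert (H := le_of_derive_nonneg
  (fun x => exp x + exp (- x) - (2 + x ^ 2 + x ^ 4 / 12 + x ^ 6 / 360))
  (fun x => exp x - exp (- x) - (2 * x + x ^ 3 / 3 + x ^ 5 / 60)) 0 s Hs).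
cbv beta in H. rewrite Ropp_0, exp_0 in H.
assert (1 + 1 - (2 + 0 ^ 2 + 0 ^ 4 / 12 + 0 ^ 6 / 360)
        <= exp s + exp (- s) - (2 + s ^ 2 + s ^ 4 / 12 + s ^ 6 / 360)); [apply H | lra].
- intros x _. auto_derive; [trivial | field].
- intros x Hx. pose proof (H6 x (proj1 Hx)); lra.
Qed.

Lemma one_sub_exp_opp_sqr (s : R) : (1 - exp (- s)) ^ 2 = exp (- s) * dcosh s.
Proof.
unfold dcosh. assert (exp (- s) * exp s = 1) by (rewrite <- exp_plus, Rplus_opp_l; apply exp_0).
nra.
Qed.

Lemma exp_opp_lt_1 (s : R) : 0 < s -> 0 < exp (- s) < 1.
Proof.
intros Hs. split; [apply exp_pos |]. rewrite <- exp_0. apply exp_increasing; lra.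
Qed.

(* Upper bounds for the polylogarithms [Li_(-j) (exp (- s))], [j = 1, 2, 3]. *)
Lemma polylog1_le (s : R) : 0 < s -> exp (- s) / (1 - exp (- s)) ^ 2 <= 1 / s ^ 2.
Proof.
intros Hs. destruct (exp_opp_lt_1 s Hs) as [Hz Hz1].
pose proof (dcosh_ge s (Rlt_le _ _ Hs)) as HD.
assert (0 < s ^ 2) by (apply pow_lt; lra).
assert (0 < s ^ 4) by (apply pow_lt; lra).
assert (0 < s ^ 6) by (apply pow_lt; lra).
rewrite one_sub_exp_opp_sqr.
replace (exp (- s) / (exp (- s) * dcosh s)) with (1 / dcosh s) by (field; lra).
unfold Rdiv. rewrite !Rmult_1_l. apply Rinv_le_contravar; lra.
Qed.

Lemma polylog2_le (s : R) :
  0 < s -> exp (- s) * (1 + exp (- s)) / (1 - exp (- s)) ^ 3 <= 2 / s ^ 3.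
Proof.
intros Hs. destruct (exp_opp_lt_1 s Hs) as [Hz Hz1].
pose proof (dcosh_ge s (Rlt_le _ _ Hs)) as HD.
pose proof (one_sub_exp_opp_sqr s) as Hsq.
set (z := exp (- s)) in *. set (D := dcosh s) in *.
assert (Hb : 0 < s ^ 2) by (apply pow_lt; lra).
replace (s ^ 4) with ((s ^ 2) ^ 2) in HD by ring.
replace (s ^ 6) with ((s ^ 2) ^ 3) in HD by ring.
assert (H3 : 0 < s ^ 3) by (apply pow_lt; lra).
assert (H3z : 0 < (1 - z) ^ 3) by (apply pow_lt; lra).
assert (Hmain : (s ^ 2) ^ 3 * (D + 4) <= 4 * D ^ 3).
{ set (b := s ^ 2) in *. set (g := 1 + b / 12 + b ^ 2 / 360).
  assert (Hg : 1 <= g) by (unfold g; nra).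
  assert (HDg : b * g <= D) by (unfold g; lra).
  assert (Hg3 : b * g + 4 <= 4 * g ^ 3)
    by (assert (forall k, 0 <= b ^ k) by (intro; apply pow_le; lra);
        pose proof (H 2%nat); pose proof (H 3%nat); pose proof (H 4%nat);
        pose proof (H 5%nat); pose proof (H 6%nat); unfold g; lra).
  assert (Hr : D >= b * g) by lra.
  assert (HDb : b <= D) by nra.
  assert (0 <= b ^ 3) by (apply pow_le; lra).
  assert (E1 : b ^ 3 * (b * g + 4) <= 4 * (b * g) ^ 3)
    by (replace (4 * (b * g) ^ 3) with (b ^ 3 * (4 * g ^ 3)) by ring;
        apply Rmult_le_compat_l; lra).
  assert (E2 : 0 <= (D - b * g) * (4 * (D ^ 2 + D * (b * g) + (b * g) ^ 2) - b ^ 3)).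
  { apply Rmult_le_pos; [lra |].
    assert (b <= b * g) by nra.
    assert (b ^ 2 * g ^ 2 <= D ^ 2) by (replace (b ^ 2 * g ^ 2) with ((b * g) ^ 2) by ring;
      apply pow_incr; nra).
    assert (b <= 4 * g ^ 2) by (unfold g; nra).
    assert (b ^ 2 * b <= b ^ 2 * (4 * g ^ 2)) by (apply Rmult_le_compat_l; nra).
    assert (0 <= D * (b * g)) by nra. nra. }
  nra. }
(* Squared, the bound involves [z] only through [D]: [(1 - z) ^ 2 = z * D] and
   [(1 + z) ^ 2 = z * (D + 4)]. *)
apply Rsqr_incr_0_var; [| apply Rlt_le, Rdiv_lt_0_compat; lra].
unfold Rsqr.
replace (z * (1 + z) / (1 - z) ^ 3 * (z * (1 + z) / (1 - z) ^ 3))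
  with (z ^ 2 * (1 + z) ^ 2 / ((1 - z) ^ 2) ^ 3) by (field; lra).
replace (2 / s ^ 3 * (2 / s ^ 3)) with (4 / (s ^ 2) ^ 3) by (field; lra).
assert (HDpos : 0 < D) by nra.
replace ((1 + z) ^ 2) with (z * (D + 4)) by (rewrite Rmult_plus_distr_l, <- Hsq; ring).
rewrite Hsq.
replace (z ^ 2 * (z * (D + 4)) / (z * D) ^ 3) with ((D + 4) / D ^ 3) by (field; lra).
apply Rmult_le_reg_r with (D ^ 3 * (s ^ 2) ^ 3).
{ apply Rmult_lt_0_compat; apply pow_lt; lra. }
replace ((D + 4) / D ^ 3 * (D ^ 3 * (s ^ 2) ^ 3)) with ((s ^ 2) ^ 3 * (D + 4)) by (field; lra).
replace (4 / (s ^ 2) ^ 3 * (D ^ 3 * (s ^ 2) ^ 3)) with (4 * D ^ 3) by (field; lra).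
exact Hmain.
Qed.

Lemma polylog3_le (s : R) :
  0 < s -> exp (- s) * (1 + 4 * exp (- s) + exp (- s) ^ 2) / (1 - exp (- s)) ^ 4 <= (31 / 5) / s ^ 4.
Proof.
intros Hs. destruct (exp_opp_lt_1 s Hs) as [Hz Hz1].
pose proof (dcosh_ge s (Rlt_le _ _ Hs)) as HD.
pose proof (one_sub_exp_opp_sqr s) as Hsq.
set (z := exp (- s)) in *. set (D := dcosh s) in *.
assert (Hb : 0 < s ^ 2) by (apply pow_lt; lra).
replace (s ^ 4) with ((s ^ 2) ^ 2) in * by ring.
replace (s ^ 6) with ((s ^ 2) ^ 3) in HD by ring.
set (b := s ^ 2) in *. set (g := 1 + b / 12 + b ^ 2 / 360).
assert (Hg : 1 <= g) by (unfold g; nra).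
assert (HDg : b * g <= D) by (unfold g; lra).
assert (HDpos : 0 < D) by nra.
(* The expansion at [s = 0] begins [6 / s ^ 4 + 1 / 120], so the constant 6 would fail. With
   [31 / 5] the only negative coefficient of the difference, that of [b ^ 2], is absorbed by the
   square of [b ^ 2 - 61]. *)
assert (Hg2 : b * g + 6 <= (31 / 5) * g ^ 2).
{ unfold g.
  pose proof (pow2_ge_0 (b ^ 2 - 61)); pose proof (pow2_ge_0 b). assert (0 <= b ^ 3) by (apply pow_le; lra).
  lra. }
replace (1 + 4 * z + z ^ 2) with (z * (D + 6)) by (rewrite Rmult_plus_distr_l, <- Hsq; ring).
replace ((1 - z) ^ 4) with (((1 - z) ^ 2) ^ 2) by ring. rewrite Hsq.
replace (z * (z * (D + 6)) / (z * D) ^ 2) with ((D + 6) / D ^ 2) by (field; lra).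
apply Rle_trans with ((b * g + 6) / (b * g) ^ 2).
- assert (0 < b * g) by nra.
  apply Rmult_le_reg_r with (D ^ 2 * (b * g) ^ 2).
  { apply Rmult_lt_0_compat; apply pow_lt; lra. }
  replace ((D + 6) / D ^ 2 * (D ^ 2 * (b * g) ^ 2)) with ((D + 6) * (b * g) ^ 2) by (field; lra).
  replace ((b * g + 6) / (b * g) ^ 2 * (D ^ 2 * (b * g) ^ 2)) with ((b * g + 6) * D ^ 2)
    by (field; lra).
  set (B := b * g) in *.
  assert (0 <= (D - B) * (D * B + 6 * (D + B))) by (apply Rmult_le_pos; nra). nra.
- apply Rmult_le_reg_r with (g ^ 2 * b ^ 2).
  { apply Rmult_lt_0_compat; apply pow_lt; lra. }
  replace ((b * g + 6) / (b * g) ^ 2 * (g ^ 2 * b ^ 2)) with (b * g + 6) by (field; lra).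
  replace ((31 / 5) / b ^ 2 * (g ^ 2 * b ^ 2)) with ((31 / 5) * g ^ 2) by (field; lra).
  exact Hg2.
Qed.

(** * Moments of the tilted distribution *)

Fixpoint lsum (f : nat -> R) (ks : list nat) : R :=
  match ks with nil => 0 | k :: ks' => f k + lsum f ks' end.

Lemma lsum_le (f g : nat -> R) (ks : list nat) :
  (forall k, In k ks -> f k <= g k) -> lsum f ks <= lsum g ks.
Proof.
induction ks as [| k ks IH]; intros H; simpl; [lra |].
apply Rplus_le_compat; [apply H; now left | apply IH; intros; apply H; now right].
Qed.

Lemma lsum_ext (f g : nat -> R) (ks : list nat) :
  (forall k, In k ks -> f k = g k) -> lsum f ks = lsum g ks.
Proof. intros H; apply Rle_antisym; apply lsum_le; intros; rewrite H; auto; lra. Qed.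

Lemma lsum_scal (c : R) (f : nat -> R) (ks : list nat) :
  lsum (fun k => c * f k) ks = c * lsum f ks.
Proof. induction ks as [| k ks IH]; simpl; [| rewrite IH]; ring. Qed.

Lemma lsum_plus (f g : nat -> R) (ks : list nat) :
  lsum (fun k => f k + g k) ks = lsum f ks + lsum g ks.
Proof. induction ks as [| k ks IH]; simpl; [| rewrite IH]; ring. Qed.

Lemma lsum_nonneg (f : nat -> R) (ks : list nat) :
  (forall k, In k ks -> 0 <= f k) -> 0 <= lsum f ks.
Proof.
induction ks as [| k ks IH]; intros H; simpl; [lra |].
apply Rplus_le_le_0_compat; [apply H; now left | apply IH; intros; apply H; now right].
Qed.

Lemma Rabs_lsum_le (f : nat -> R) (ks : list nat) :
  Rabs (lsum f ks) <= lsum (fun k => Rabs (f k)) ks.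
Proof.
induction ks as [| k ks IH]; simpl; [rewrite Rabs_R0; lra |].
eapply Rle_trans; [apply Rabs_triang | lra].
Qed.

Lemma lsum_comm (f : nat -> nat -> R) (ks ms : list nat) :
  lsum (fun k => lsum (f k) ms) ks = lsum (fun m => lsum (fun k => f k m) ks) ms.
Proof.
induction ks as [| k ks IH]; simpl.
- induction ms as [| m ms IHm]; simpl; [| rewrite <- IHm]; ring.
- rewrite IH, <- lsum_plus. now apply lsum_ext.
Qed.

Lemma is_lim_seq_lsum (f : nat -> nat -> R) (l : nat -> R) (ks : list nat) :
  (forall k, In k ks -> is_lim_seq (f k) (l k)) ->
  is_lim_seq (fun n => lsum (fun k => f k n) ks) (lsum l ks).
Proof.
induction ks as [| k ks IH]; intros H; simpl; [apply is_lim_seq_const |].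
apply is_lim_seq_plus'; [apply H; now left | apply IH; intros; apply H; now right].
Qed.

(* [power_tail i z a] is [sum_(m >= a) m ^ i z ^ m], for [i <= 3]. *)
Definition power_tail (i : nat) (z : R) (a : nat) : R :=
  let l0 := 1 / (1 - z) in let l1 := z / (1 - z) ^ 2 in
  let l2 := z * (1 + z) / (1 - z) ^ 3 in
  let l3 := z * (1 + 4 * z + z ^ 2) / (1 - z) ^ 4 in
  z ^ a * match i with
          | O => l0
          | S O => INR a * l0 + l1
          | S (S O) => INR a ^ 2 * l0 + 2 * INR a * l1 + l2
          | _ => INR a ^ 3 * l0 + 3 * INR a ^ 2 * l1 + 3 * INR a * l2 + l3
          end.

Lemma power_tail_step (i : nat) (z : R) (a : nat) : (i <= 3)%nat -> z < 1 ->
  power_tail i z a = INR a ^ i * z ^ a + power_tail i z (S a).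
Proof.
intros Hi Hz. unfold power_tail. rewrite S_INR. simpl (z ^ S a).
destruct i as [| [| [| [| i]]]]; [| | | | lia]; field; lra.
Qed.

Lemma power_tail_nonneg (i : nat) (z : R) (a : nat) : 0 < z < 1 -> 0 <= power_tail i z a.
Proof.
intros Hz. unfold power_tail.
assert (H0 : 0 <= 1 / (1 - z)) by (apply Rlt_le, Rdiv_lt_0_compat; lra).
assert (H1 : 0 <= z / (1 - z) ^ 2) by (apply Rlt_le, Rdiv_lt_0_compat; [lra | apply pow_lt; lra]).
assert (H2 : 0 <= z * (1 + z) / (1 - z) ^ 3)
  by (apply Rlt_le, Rdiv_lt_0_compat; [nra | apply pow_lt; lra]).
assert (H3 : 0 <= z * (1 + 4 * z + z ^ 2) / (1 - z) ^ 4)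
  by (apply Rlt_le, Rdiv_lt_0_compat; [pose proof (pow2_ge_0 z); apply Rmult_lt_0_compat; lra | apply pow_lt; lra]).
assert (Ha := pos_INR a).
assert (Ha2 : 0 <= INR a ^ 2) by (apply pow_le; lra).
assert (Ha3 : 0 <= INR a ^ 3) by (apply pow_le; lra).
apply Rmult_le_pos; [apply pow_le; lra |].
destruct i as [| [| [| i]]]; [assumption | | |];
  repeat (assumption || apply Rplus_le_le_0_compat || apply Rmult_le_pos); lra.
Qed.

Lemma lsum_power (i : nat) (z : R) (a N : nat) : (i <= 3)%nat -> z < 1 ->
  lsum (fun m => INR m ^ i * z ^ m) (seq a N) = power_tail i z a - power_tail i z (a + N).
Proof.
intros Hi Hz. revert a. induction N as [| N IH]; intros a; simpl lsum.
- rewrite Nat.add_0_r. ring.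
- rewrite IH, (power_tail_step i z a) by assumption. rewrite Nat.add_succ_r. simpl. ring.
Qed.

(** Each of the [n] terms of [1 + r + ... + r ^ (n - 1)] is at least [r ^ n]. *)
Lemma INR_mul_pow_le (r : R) (n : nat) : 0 < r < 1 -> INR n * r ^ n <= 1 / (1 - r).
Proof.
intros Hr.
assert (INR n * r ^ n <= lsum (fun m => INR m ^ 0 * r ^ m) (seq 0 n)).
{ replace (INR n * r ^ n) with (lsum (fun _ => r ^ n) (seq 0 n)).
  - apply lsum_le. intros k Hk. apply in_seq in Hk. simpl. rewrite Rmult_1_l.
    replace n with (k + (n - k))%nat by lia. rewrite pow_add.
    rewrite <- (Rmult_1_r (r ^ k)) at 2. apply Rmult_le_compat_l; [apply pow_le; lra |].
    rewrite <- (pow1 (n - k)). apply pow_incr; lra.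
  - generalize (r ^ n); intros c. generalize 0%nat as a. induction n as [| n IHn]; intros a.
    + simpl; ring.
    + cbn [seq lsum]. rewrite IHn, S_INR. ring. }
rewrite lsum_power in H by (lia || lra). pose proof (power_tail_nonneg 0 r (0 + n) Hr).
unfold power_tail at 1 in H. simpl pow in H. lra.
Qed.

Lemma is_lim_seq_pow_mul (i : nat) (z : R) : 0 < z < 1 ->
  is_lim_seq (fun n => INR n ^ i * z ^ n) 0.
Proof.
revert z. induction i as [| i IH]; intros z Hz.
- apply is_lim_seq_ext with (fun n => z ^ n); [intros n; simpl; ring |].
  apply is_lim_seq_geom. rewrite Rabs_pos_eq; lra.
(* Half of the decay, one factor [sqrt z ^ n], absorbs one power of [n]; the other half is left to
   the induction hypothesis. *)
- assert (Hr : 0 < sqrt z < 1).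
  { split; [apply sqrt_lt_R0; lra |]. rewrite <- sqrt_1. apply sqrt_lt_1; lra. }
  assert (Hzz : z = sqrt z * sqrt z) by (rewrite sqrt_sqrt; lra).
  set (r := sqrt z) in *. clearbody r. subst z.
  apply is_lim_seq_le_le with (fun _ => 0) (fun n => 1 / (1 - r) * (INR n ^ i * r ^ n)).
  + intros n. rewrite Rpow_mult_distr. pose proof (INR_mul_pow_le r n Hr).
    assert (0 <= INR n ^ i * r ^ n)
      by (apply Rmult_le_pos; apply pow_le; [apply pos_INR | lra]).
    assert (0 <= INR n * r ^ n)
      by (apply Rmult_le_pos; [apply pos_INR | apply pow_le; lra]).
    replace (INR n ^ S i * (r ^ n * r ^ n)) with (INR n * r ^ n * (INR n ^ i * r ^ n))
      by (simpl; ring).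
    split; [now apply Rmult_le_pos | now apply Rmult_le_compat_r].
  + apply is_lim_seq_const.
  + replace (Finite 0) with (Rbar_mult (1 / (1 - r)) 0) by (simpl; f_equal; ring).
    apply is_lim_seq_scal_l. now apply IH.
Qed.

Lemma is_lim_seq_power_tail (i : nat) (z : R) : (i <= 2)%nat -> 0 < z < 1 ->
  is_lim_seq (power_tail i z) 0.
Proof.
intros Hi Hz.
pose proof (is_lim_seq_pow_mul 0 z Hz) as L0. pose proof (is_lim_seq_pow_mul 1 z Hz) as L1.
pose proof (is_lim_seq_pow_mul 2 z Hz) as L2.
set (l0 := 1 / (1 - z)). set (l1 := z / (1 - z) ^ 2). set (l2 := z * (1 + z) / (1 - z) ^ 3).
assert (G : forall a b c, is_lim_seq
  (fun n => a * (INR n ^ 2 * z ^ n) + (b * (INR n ^ 1 * z ^ n) + c * (INR n ^ 0 * z ^ n))) 0).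
{ intros a b c. replace (Finite 0) with (Finite (a * 0 + (b * 0 + c * 0))) by (f_equal; ring).
  repeat apply is_lim_seq_plus'; now apply is_lim_seq_scal_l with (lu := Finite 0). }
unfold power_tail. fold l0 l1 l2.
destruct i as [| [| [| i]]]; [| | | lia].
- eapply is_lim_seq_ext; [| apply (G 0 0 l0)]. intros n. simpl. ring.
- eapply is_lim_seq_ext; [| apply (G 0 l0 l1)]. intros n. simpl. ring.
- eapply is_lim_seq_ext; [| apply (G l0 (2 * l1) l2)]. intros n. simpl. ring.
Qed.

(** From [m = 3] on, [1 / m ^ 2 <= 1 / (m - 1/2) - 1 / (m + 1/2)] telescopes to at most [2 / 5];
    with the exact terms [1 + 1 / 4] this gives [33 / 20]. *)
Lemma lsum_inv_sqr_le (M : nat) : lsum (fun m => 1 / INR m ^ 2) (seq 1 M) <= 33 / 20.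
Proof.
assert (H : forall a, (3 <= a)%nat -> forall N,
  lsum (fun m => 1 / INR m ^ 2) (seq a N) <= 1 / (INR a - 1 / 2)).
{ intros a Ha N. revert a Ha. induction N as [| N IH]; intros a Ha;
    assert (3 <= INR a) by (change 3 with (IZR (Z.of_nat 3)); rewrite <- INR_IZR_INZ; now apply le_INR).
  - simpl. apply Rlt_le, Rdiv_lt_0_compat; lra.
  - cbn [seq lsum]. specialize (IH (S a) ltac:(lia)). rewrite S_INR in IH.
    assert (1 / INR a ^ 2 <= 1 / (INR a - 1 / 2) - 1 / (INR a + 1 - 1 / 2)); [| lra].
    replace (1 / (INR a - 1 / 2) - 1 / (INR a + 1 - 1 / 2)) with (1 / (INR a ^ 2 - 1 / 4))
      by (field; nra).
    unfold Rdiv; rewrite !Rmult_1_l. apply Rinv_le_contravar; nra. }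
destruct M as [| [| M]]; [simpl; lra | simpl; lra |].
cbn [seq lsum]. specialize (H 3%nat (le_n _) M).
simpl INR in *. lra.
Qed.

(** With [W (y) = sum_m m ^ i y ^ m], exchanging the sums over [k] and [m] leaves [sum_m m ^ i sum_k
    k ^ (i + 1) exp (- m t) ^ k]. The hypothesis at [s = m t] bounds the inner sum by
    [c / (m t) ^ (i + 2)], so what remains is [c / t ^ (i + 2)] times [sum_m 1 / m ^ 2]. *)
Lemma lsum_divisor_bound (i : nat) (c t : R) (W : R -> R) (ks : list nat) :
  0 < t -> (forall k, In k ks -> (1 <= k)%nat) ->
  (forall y, 0 < y < 1 ->
     is_lim_seq (fun M => lsum (fun m => INR m ^ i * y ^ m) (seq 1 M)) (W y)) ->
  (forall s, 0 < s -> lsum (fun k => INR k ^ S i * exp (- s) ^ k) ks <= c / s ^ (i + 2)) ->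
  lsum (fun k => INR k ^ S i * W (exp (- t) ^ k)) ks <= c * (33 / 20) / t ^ (i + 2).
Proof.
intros Ht Hks HW Hb. destruct (exp_opp_lt_1 t Ht) as [Hx Hx1].
assert (Hy : forall k, (1 <= k)%nat -> 0 < exp (- t) ^ k < 1).
{ intros k Hk. split; [now apply pow_lt |]. destruct k as [| k]; [lia |]. simpl.
  assert (0 < exp (- t) ^ k <= 1); [| nra].
  split; [now apply pow_lt |]. rewrite <- (pow1 k). apply pow_incr; lra. }
assert (Hpow : forall k, exp (- t) ^ k = exp (- (INR k * t))).
{ intros k. induction k as [| k IH].
  - simpl. rewrite Rmult_0_l, Ropp_0, exp_0. reflexivity.
  - rewrite S_INR. simpl. rewrite IH, <- exp_plus. f_equal. ring. }
assert (Hlim := is_lim_seq_lsum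
  (fun k M => INR k ^ S i * lsum (fun m => INR m ^ i * (exp (- t) ^ k) ^ m) (seq 1 M))
  (fun k => INR k ^ S i * W (exp (- t) ^ k)) ks).
assert (Hc : 0 <= c).
{ specialize (Hb 1 Rlt_0_1). rewrite pow1, Rdiv_1_r in Hb.
  eapply Rle_trans; [| apply Hb]. apply lsum_nonneg. intros k _.
  apply Rmult_le_pos; apply pow_le; [apply pos_INR | apply Rlt_le, exp_pos]. }
apply (is_lim_seq_le
  (fun M => lsum (fun k => INR k ^ S i
     * lsum (fun m => INR m ^ i * (exp (- t) ^ k) ^ m) (seq 1 M)) ks)
  (fun _ => c * (33 / 20) / t ^ (i + 2))
  (lsum (fun k => INR k ^ S i * W (exp (- t) ^ k)) ks) (c * (33 / 20) / t ^ (i + 2)));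
  [| apply Hlim | apply is_lim_seq_const].
- intros M.
  replace (lsum _ ks) with
    (lsum (fun m => INR m ^ i * lsum (fun k => INR k ^ S i * exp (- (INR m * t)) ^ k) ks) (seq 1 M)).
  + apply Rle_trans with (lsum (fun m => c / t ^ (i + 2) * (1 / INR m ^ 2)) (seq 1 M)).
    * apply lsum_le. intros m Hm. apply in_seq in Hm.
      assert (Hm0 : 0 < INR m) by (apply lt_0_INR; lia).
      replace (c / t ^ (i + 2) * (1 / INR m ^ 2))
        with (INR m ^ i * (c / (INR m * t) ^ (i + 2))).
      -- apply Rmult_le_compat_l; [apply pow_le; lra | apply Hb; nra].
      -- rewrite Rpow_mult_distr, pow_add. field.
         repeat split; try apply pow_nonzero; lra.
    * rewrite lsum_scal. pose proof (lsum_inv_sqr_le M).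
      replace (c * (33 / 20) / t ^ (i + 2)) with (c / t ^ (i + 2) * (33 / 20))
        by (field; apply pow_nonzero; lra).
      apply Rmult_le_compat_l; [| assumption].
      apply Rdiv_le_0_compat; [assumption | now apply pow_lt].
  + rewrite (lsum_ext (fun m => INR m ^ i * _) (fun m =>
      lsum (fun k => INR m ^ i * (INR k ^ S i * exp (- (INR m * t)) ^ k)) ks))
      by (intros; symmetry; apply lsum_scal).
    rewrite <- lsum_comm. apply lsum_ext. intros k _. rewrite <- lsum_scal.
    apply lsum_ext. intros m _. rewrite <- Hpow, <- !pow_mult, (Nat.mul_comm m k). ring.
- intros k Hk. apply is_lim_seq_scal_l with (lu := Finite (W (exp (- t) ^ k))).
  apply HW, Hy, Hks, Hk.
Qed.

Lemma lsum_power_le_polylog (i : nat) (z : R) (N : nat) : (i <= 3)%nat -> 0 < z < 1 ->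
  lsum (fun m => INR m ^ i * z ^ m) (seq 2 N) <= power_tail i z 1.
Proof.
intros Hi Hz. rewrite lsum_power, (power_tail_step i z 1) by (tauto || lra).
pose proof (power_tail_nonneg i z (2 + N) Hz).
assert (0 <= INR 1 ^ i * z ^ 1) by (apply Rmult_le_pos; apply pow_le; simpl; lra). lra.
Qed.

Lemma is_lim_seq_lsum_power (i : nat) (y : R) : (i <= 2)%nat -> 0 < y < 1 ->
  is_lim_seq (fun M => lsum (fun m => INR m ^ i * y ^ m) (seq 1 M)) (power_tail i y 1).
Proof.
intros Hi Hy.
apply is_lim_seq_ext with (fun M => power_tail i y 1 - power_tail i y (1 + M)).
{ intros M. rewrite lsum_power by (lia || lra). reflexivity. }
replace (Finite (power_tail i y 1)) with (Finite (power_tail i y 1 - 0)) by (f_equal; ring).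
apply is_lim_seq_minus'; [apply is_lim_seq_const |].
apply (is_lim_seq_incr_1 (power_tail i y)). now apply is_lim_seq_power_tail.
Qed.

Lemma In_seq2_ge1 (N k : nat) : In k (seq 2 N) -> (1 <= k)%nat.
Proof. intros H. apply in_seq in H. lia. Qed.

(** If the multiplicity of each part [k] is an independent geometric variable of ratio
    [exp (- t) ^ k], the sums here and in the next two lemmas are the first three cumulants of the
    partitioned integer, hence the Taylor coefficients of [log F (x e^(i th))] at 0 up to factorials
    and powers of [i]. *)
Lemma mean_le (t : R) (N : nat) : 0 < t ->
  lsum (fun k => INR k * (exp (- t) ^ k / (1 - exp (- t) ^ k))) (seq 2 N) <= 33 / 20 / t ^ 2.
Proof.
intros Ht.
assert (H := lsum_divisor_bound 0 1 t (fun y => y / (1 - y)) (seq 2 N) Ht (In_seq2_ge1 N)).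
simpl (0 + 2)%nat in H. rewrite Rmult_1_l in H.
rewrite (lsum_ext _ (fun k => INR k ^ 1 * (exp (- t) ^ k / (1 - exp (- t) ^ k))))
  by (intros; simpl; ring).
apply H.
- intros y Hy. replace (y / (1 - y)) with (power_tail 0 y 1)
    by (unfold power_tail; simpl; field; lra). now apply is_lim_seq_lsum_power; [lia |].
- intros s Hs. destruct (exp_opp_lt_1 s Hs).
  eapply Rle_trans; [apply lsum_power_le_polylog; [lia | auto] |].
  eapply Rle_trans; [| apply polylog1_le, Hs]. right. unfold power_tail. simpl. field. lra.
Qed.

Lemma variance_le (t : R) (N : nat) : 0 < t ->
  lsum (fun k => INR k ^ 2 * (exp (- t) ^ k / (1 - exp (- t) ^ k) ^ 2)) (seq 2 N)
  <= 33 / 10 / t ^ 3.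
Proof.
intros Ht.
assert (H := lsum_divisor_bound 1 2 t (fun y => y / (1 - y) ^ 2) (seq 2 N) Ht (In_seq2_ge1 N)).
simpl (1 + 2)%nat in H. replace (2 * (33 / 20)) with (33 / 10) in H by field.
apply H.
- intros y Hy. replace (y / (1 - y) ^ 2) with (power_tail 1 y 1)
    by (unfold power_tail; simpl; field; lra). now apply is_lim_seq_lsum_power; [lia |].
- intros s Hs. destruct (exp_opp_lt_1 s Hs).
  eapply Rle_trans; [apply lsum_power_le_polylog; [lia | auto] |].
  eapply Rle_trans; [| apply polylog2_le, Hs]. right. unfold power_tail. simpl. field. lra.
Qed.

Lemma third_cumulant_le (t : R) (N : nat) : 0 < t ->
  lsum (fun k => INR k ^ 3 * (exp (- t) ^ k * (1 + exp (- t) ^ k) / (1 - exp (- t) ^ k) ^ 3))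
    (seq 2 N) <= 1023 / 100 / t ^ 4.
Proof.
intros Ht.
assert (H := lsum_divisor_bound 2 (31 / 5) t (fun y => y * (1 + y) / (1 - y) ^ 3)
  (seq 2 N) Ht (In_seq2_ge1 N)).
simpl (2 + 2)%nat in H. replace (31 / 5 * (33 / 20)) with (1023 / 100) in H by field.
apply H.
- intros y Hy. replace (y * (1 + y) / (1 - y) ^ 3) with (power_tail 2 y 1)
    by (unfold power_tail; simpl; field; lra). now apply is_lim_seq_lsum_power; [lia |].
- intros s Hs. destruct (exp_opp_lt_1 s Hs).
  eapply Rle_trans; [apply lsum_power_le_polylog; [lia | auto] |].
  eapply Rle_trans; [| apply polylog3_le, Hs]. right. unfold power_tail. simpl. field. lra.
Qed.

(** * Modulus and argument of a geometric factor *)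

(* [(1 - y) / (1 - y * exp (i a)) = exp (- lmod y a + i * arg y a)] *)
Definition lmod (y a : R) : R := ln (1 + 2 * y * (1 - cos a) / (1 - y) ^ 2) / 2.
Definition arg (y a : R) : R := atan (y * sin a / (1 - y * cos a)).

Lemma sin_sqr (a : R) : sin a ^ 2 = 1 - cos a ^ 2.
Proof. pose proof (sin2_cos2 a) as H. unfold Rsqr in H. simpl. lra. Qed.

Lemma norm_sqr_pos (y a : R) : 0 <= y < 1 -> 0 < 1 - 2 * y * cos a + y ^ 2.
Proof. intros Hy. pose proof (COS_bound a). nra. Qed.

Lemma re_pos (y a : R) : 0 <= y < 1 -> 0 < 1 - y * cos a.
Proof. intros Hy. pose proof (COS_bound a). nra. Qed.

Lemma gain_nonneg (y a : R) : 0 <= y < 1 -> 0 <= 2 * y * (1 - cos a) / (1 - y) ^ 2.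
Proof.
intros Hy. pose proof (COS_bound a).
apply Rdiv_le_0_compat; [nra | apply pow_lt; lra].
Qed.

Lemma lmod_nonneg (y a : R) : 0 <= y < 1 -> 0 <= lmod y a.
Proof.
intros Hy. pose proof (gain_nonneg y a Hy). unfold lmod.
rewrite <- ln_1. assert (ln 1 <= ln (1 + 2 * y * (1 - cos a) / (1 - y) ^ 2)); [| rewrite ln_1 in *; lra].
destruct (Req_dec (2 * y * (1 - cos a) / (1 - y) ^ 2) 0) as [-> | ]; [rewrite Rplus_0_r; lra |].
apply Rlt_le, ln_increasing; lra.
Qed.

Lemma lmod_le (y a : R) : 0 <= y < 1 -> lmod y a <= y / (1 - y) ^ 2 * a ^ 2 / 2.
Proof.
intros Hy. pose proof (gain_nonneg y a Hy). unfold lmod.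
assert (Hq : 0 <= y / (1 - y) ^ 2) by (apply Rdiv_le_0_compat; [lra | apply pow_lt; lra]).
pose proof (one_sub_cos_le_half_sqr a).
assert (2 * y * (1 - cos a) / (1 - y) ^ 2 <= y / (1 - y) ^ 2 * a ^ 2).
{ replace (2 * y * (1 - cos a) / (1 - y) ^ 2) with (y / (1 - y) ^ 2 * (2 * (1 - cos a)))
    by (field; lra). apply Rmult_le_compat_l; lra. }
set (u := 2 * y * (1 - cos a) / (1 - y) ^ 2) in *.
assert (ln (1 + u) <= u); [| lra].
rewrite <- (ln_exp u) at 2. destruct (Req_dec u 0) as [-> | ].
- rewrite Rplus_0_r, exp_0. lra.
- apply Rlt_le, ln_increasing; [lra |]. apply exp_ineq1. lra.
Qed.

Lemma lmod_eq (y a : R) : 0 <= y < 1 ->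
  lmod y a = ln (1 - 2 * y * cos a + y ^ 2) / 2 - ln (1 - y).
Proof.
intros Hy. unfold lmod. pose proof (norm_sqr_pos y a Hy).
replace (1 + 2 * y * (1 - cos a) / (1 - y) ^ 2)
  with ((1 - 2 * y * cos a + y ^ 2) / ((1 - y) * (1 - y))) by (field; lra).
assert (0 < (1 - y) * (1 - y)) by nra.
rewrite ln_div, ln_mult by lra. field.
Qed.

(* The right-hand side is the first term of the series [sum_(m >= 1) y ^ m (1 - cos (m a)) / m]
   of [lmod y a]. *)
Lemma lmod_ge (y a : R) : 0 <= y < 1 -> y * (1 - cos a) <= lmod y a.
Proof.
intros Hy. rewrite lmod_eq by assumption. pose proof (COS_bound a) as Hc. set (c := cos a) in *.
assert (Hd : forall x, 0 <= x <= y -> 0 < 1 - 2 * x * c + x ^ 2) by (intros; apply norm_sqr_pos; lra).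
assert (H := le_of_derive_nonneg
  (fun x => ln (1 - 2 * x * c + x ^ 2) / 2 - ln (1 - x) - x * (1 - c))
  (fun x => (x - c) / (1 - 2 * x * c + x ^ 2) + 1 / (1 - x) - (1 - c)) 0 y (proj1 Hy)).
cbv beta in H.
replace (1 - 2 * 0 * c + 0 ^ 2) with 1 in H by ring.
replace (1 - 0) with 1 in H by ring. rewrite ln_1 in H.
assert (0 / 2 - 0 - 0 * (1 - c) <= ln (1 - 2 * y * c + y ^ 2) / 2 - ln (1 - y) - y * (1 - c));
  [apply H | lra].
- intros x Hx. specialize (Hd x Hx). auto_derive; [repeat split; lra | field; lra].
- intros x Hx. specialize (Hd x Hx).
  replace ((x - c) / (1 - 2 * x * c + x ^ 2) + 1 / (1 - x) - (1 - c))
    with ((1 - c) * ((1 + x) - (1 - x) * (1 - 2 * x * c + x ^ 2))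
          / ((1 - 2 * x * c + x ^ 2) * (1 - x))) by (field; lra).
  apply Rdiv_le_0_compat; [| nra]. apply Rmult_le_pos; [lra |].
  assert (1 - 2 * x * c + x ^ 2 <= (1 + x) ^ 2) by nra.
  assert ((1 - x) * (1 - 2 * x * c + x ^ 2) <= (1 - x) * (1 + x) ^ 2)
    by (apply Rmult_le_compat_l; lra).
  assert (0 <= x ^ 2 * (1 + x)) by (apply Rmult_le_pos; nra). nra.
Qed.

Lemma is_derive_arg (y a : R) : 0 <= y < 1 ->
  is_derive (arg y) a ((y * cos a - y ^ 2) / (1 - 2 * y * cos a + y ^ 2)).
Proof.
intros Hy. pose proof (re_pos y a Hy). pose proof (norm_sqr_pos y a Hy).
unfold arg. pose proof (sin_sqr a) as Hs.
auto_derive; [lra |].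
match goal with |- ?l = _ => replace l with
  (y * (cos a * (1 - y * cos a) - y * sin a ^ 2) / ((1 - y * cos a) ^ 2 + y ^ 2 * sin a ^ 2)) end.
- rewrite Hs. field. lra.
- field. assert (0 <= y ^ 2 * sin a ^ 2) by (apply Rmult_le_pos; apply pow2_ge_0).
  assert (0 < (1 - y * cos a) ^ 2) by (apply pow_lt; lra). repeat split; nra.
Qed.

(** The derivative of [arg y] differs from its value at 0 by the nonpositive quantity [Hd], which is
    at most [q b ^ 2 / 2] in absolute value because [|1 - y e^(i b)| >= 1 - y]. Integration gives
    both bounds. *)
Lemma arg_cubic (y a : R) : 0 <= y < 1 -> 0 <= a ->
  Rabs (arg y a - a * (y / (1 - y))) <= y * (1 + y) / (1 - y) ^ 3 * a ^ 3 / 6.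
Proof.
intros Hy Ha.
assert (Hd : forall b, (y * cos b - y ^ 2) / (1 - 2 * y * cos b + y ^ 2) - y / (1 - y)
  = - (y * (1 + y) * (1 - cos b) / ((1 - y) * (1 - 2 * y * cos b + y ^ 2)))).
{ intros b. pose proof (norm_sqr_pos y b Hy). field. lra. }
assert (Hq : 0 <= y * (1 + y) / (1 - y) ^ 3) by (apply Rdiv_le_0_compat; [nra | apply pow_lt; lra]).
assert (H0 : arg y 0 = 0).
{ unfold arg. rewrite sin_0, Rmult_0_r. unfold Rdiv. rewrite Rmult_0_l. apply atan_0. }
assert (Hup : arg y a - a * (y / (1 - y)) <= 0).
{ assert (H := le_of_derive_nonneg (fun b => b * (y / (1 - y)) - arg y b)
    (fun b => y / (1 - y) - (y * cos b - y ^ 2) / (1 - 2 * y * cos b + y ^ 2)) 0 a Ha).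
  cbv beta in H. rewrite H0 in H.
  assert (0 * (y / (1 - y)) - 0 <= a * (y / (1 - y)) - arg y a); [apply H | lra].
  - intros b _. apply (is_derive_minus (fun b => b * (y / (1 - y))) (arg y)).
    + auto_derive; [trivial | ring].
    + now apply is_derive_arg.
  - intros b _. specialize (Hd b). pose proof (norm_sqr_pos y b Hy). pose proof (COS_bound b).
    assert (0 <= y * (1 + y) * (1 - cos b) / ((1 - y) * (1 - 2 * y * cos b + y ^ 2))); [| lra].
    apply Rdiv_le_0_compat; [| nra]. apply Rmult_le_pos; nra. }
assert (Hlo : - (y * (1 + y) / (1 - y) ^ 3 * a ^ 3 / 6) <= arg y a - a * (y / (1 - y))).
{ set (q := y * (1 + y) / (1 - y) ^ 3) in *.
  assert (H := le_of_derive_nonneg (fun b => arg y b + (q * b ^ 3 / 6 - b * (y / (1 - y))))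
    (fun b => (y * cos b - y ^ 2) / (1 - 2 * y * cos b + y ^ 2) + (q * b ^ 2 / 2 - y / (1 - y))) 0 a Ha).
  cbv beta in H. rewrite H0 in H.
  assert (0 + (q * 0 ^ 3 / 6 - 0 * (y / (1 - y))) <= arg y a + (q * a ^ 3 / 6 - a * (y / (1 - y))));
    [apply H | lra].
  - intros b _. apply (is_derive_plus (arg y) (fun b => q * b ^ 3 / 6 - b * (y / (1 - y)))).
    + now apply is_derive_arg.
    + auto_derive; [trivial | field; lra].
  - intros b _. specialize (Hd b). pose proof (norm_sqr_pos y b Hy). pose proof (COS_bound b).
    pose proof (one_sub_cos_le_half_sqr b).
    assert (y * (1 + y) * (1 - cos b) / ((1 - y) * (1 - 2 * y * cos b + y ^ 2)) <= q * b ^ 2 / 2);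
      [| lra].
    replace (q * b ^ 2 / 2) with (y * (1 + y) * (b ^ 2 / 2) / ((1 - y) * (1 - y) ^ 2))
      by (unfold q; field; lra).
    assert (0 < (1 - y) ^ 2) by (apply pow_lt; lra).
    assert ((1 - y) ^ 2 <= 1 - 2 * y * cos b + y ^ 2) by nra.
    unfold Rdiv. apply Rmult_le_compat.
    + apply Rmult_le_pos; nra.
    + apply Rlt_le, Rinv_0_lt_compat; nra.
    + apply Rmult_le_compat_l; nra.
    + apply Rinv_le_contravar; nra. }
assert (0 <= a ^ 3) by (apply pow_le; lra).
apply Rabs_le. split; nra.
Qed.

(** This is the real part of [(1 - y e^(i a)) * ((1 - y) / (1 - y e^(i a))) * e^(i B) = (1 - y) e^(i
    B)]; it removes one factor from the generating product. *)
Lemma mod_arg_step (y a B : R) : 0 <= y < 1 ->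
  exp (- lmod y a) * (cos (B + arg y a) - y * cos (B + arg y a + a)) = (1 - y) * cos B.
Proof.
intros Hy. pose proof (re_pos y a Hy) as Hr. pose proof (norm_sqr_pos y a Hy) as Hn.
set (D := 1 - 2 * y * cos a + y ^ 2) in *.
assert (HD : D = (1 - y * cos a) ^ 2 + (y * sin a) ^ 2)
  by (unfold D; rewrite !Rpow_mult_distr, sin_sqr; ring).
assert (Hs : 0 < sqrt D) by now apply sqrt_lt_R0.
assert (Hss : sqrt D * sqrt D = D) by (apply sqrt_sqrt; lra).
assert (Hsq : sqrt (1 + (y * sin a / (1 - y * cos a)) ^ 2) = sqrt D / (1 - y * cos a)).
{ rewrite <- (sqrt_pow2 (1 - y * cos a)) at 2 by lra.
  rewrite <- sqrt_div by (lra || (apply pow_lt; lra)). f_equal. rewrite HD. field. lra. }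
assert (Hcos : cos (arg y a) = (1 - y * cos a) / sqrt D).
{ unfold arg. rewrite cos_atan. rewrite <- Rsqr_pow2 in Hsq. rewrite Hsq. field. lra. }
assert (Hsin : sin (arg y a) = y * sin a / sqrt D).
{ unfold arg. rewrite sin_atan. rewrite <- Rsqr_pow2 in Hsq. rewrite Hsq. field. lra. }
assert (Hexp : exp (- lmod y a) = (1 - y) / sqrt D).
{ rewrite lmod_eq by assumption. fold D.
  replace (- (ln D / 2 - ln (1 - y))) with (ln (1 - y) + - (ln D / 2)) by ring.
  assert (Hh : exp (ln D / 2) = sqrt D).
  { rewrite <- Hss at 1. rewrite ln_mult by lra.
    replace ((ln (sqrt D) + ln (sqrt D)) / 2) with (ln (sqrt D)) by field. now apply exp_ln. }
  rewrite exp_plus, exp_Ropp, exp_ln, Hh by lra. reflexivity. }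
rewrite !cos_plus, !sin_plus, Hcos, Hsin, Hexp.
transitivity ((1 - y) * (cos B * ((1 - y * cos a) ^ 2 + y ^ 2 * sin a ^ 2)) / (sqrt D * sqrt D)).
- field. lra.
- rewrite Hss, HD. field. rewrite <- HD. lra.
Qed.

(** * Partition counts as Fourier coefficients *)

(* The number of partitions of [n] into parts from [ks]; the inner recursion is over the number of
   times that the part [k] is used. *)
Fixpoint parts_count (ks : list nat) (n : nat) : nat :=
  match ks with
  | nil => match n with O => 1 | S _ => 0 end
  | k :: ks' =>
      (fix add_part fuel m :=
         match fuel with
         | O => O
         | S fuel' => parts_count ks' m + if k <=? m then add_part fuel' (m - k) else 0
         end) (S n) n
  end%nat.

Lemma parts_count_cons (k : nat) (ks : list nat) (n : nat) : (1 <= k)%nat ->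
  parts_count (k :: ks) n =
    (parts_count ks n + if k <=? n then parts_count (k :: ks) (n - k) else 0)%nat.
Proof.
intros Hk. cbn [parts_count].
set (g := fix add_part fuel m := match fuel with O => O | S fuel' =>
  (parts_count ks m + if k <=? m then add_part fuel' (m - k) else 0)%nat end).
(* Fuel above [m] is always enough, since each step lowers [m] by [k >= 1]. *)
assert (Hg : forall f f' m, (m < f)%nat -> (m < f')%nat -> g f m = g f' m).
{ induction f as [| f IH]; intros [| f'] m H1 H2; try lia. simpl. f_equal.
  destruct (Nat.leb_spec k m); [apply IH; lia | reflexivity]. }
change (g (S n) n) with (parts_count ks n + if k <=? n then g n (n - k)%nat else 0)%nat.
destruct (Nat.leb_spec k n); [| reflexivity]. f_equal.
exact (Hg n (S (n - k)) (n - k)%nat ltac:(lia) ltac:(lia)).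
Qed.

(** With [F] the product of [1 / (1 - z ^ k)] over [ks], [F (x e^(i th)) / F (x)] is
    [modulus * e^(i phase)], and [wave] is the real part of its product with [e^(- i z th)]. It is
    even in [th], so half of the circle suffices. The index [z] is an integer so that the recursion
    in [fourier_cons] may go below 0. *)
Definition modulus (x : R) (ks : list nat) (th : R) : R :=
  exp (- lsum (fun k => lmod (x ^ k) (INR k * th)) ks).
Definition phase (x : R) (ks : list nat) (th : R) : R :=
  lsum (fun k => arg (x ^ k) (INR k * th)) ks.
Definition wave (x : R) (ks : list nat) (z : Z) (th : R) : R :=
  modulus x ks th * cos (phase x ks th - IZR z * th).
Definition fourier (x : R) (ks : list nat) (z : Z) : R := RInt (wave x ks z) 0 PI.

Lemma pow_lt_1 (x : R) (k : nat) : 0 < x < 1 -> (1 <= k)%nat -> 0 < x ^ k < 1.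
Proof.
intros Hx Hk. split; [now apply pow_lt |]. destruct k as [| k]; [lia |]. simpl.
assert (0 < x ^ k <= 1); [| nra].
split; [now apply pow_lt |]. rewrite <- (pow1 k). apply pow_incr; lra.
Qed.

Lemma continuous_lsum (f : nat -> R -> R) (ks : list nat) (th : R) :
  (forall k, In k ks -> continuous (f k) th) ->
  continuous (fun u => lsum (fun k => f k u) ks) th.
Proof.
induction ks as [| k ks IH]; intros H; simpl; [apply continuous_const |].
apply (continuous_plus (f k)); [apply H; now left | apply IH; intros; apply H; now right].
Qed.

Lemma continuous_modulus (x : R) (ks : list nat) (th : R) : 0 < x < 1 ->
  (forall k, In k ks -> (1 <= k)%nat) -> continuous (modulus x ks) th.
Proof.
intros Hx Hks. unfold modulus.
apply (continuous_comp (fun u => - lsum (fun k => lmod (x ^ k) (INR k * u)) ks) exp);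
  [| apply (ex_derive_continuous exp); auto_derive; trivial].
apply (continuous_opp (fun u => lsum (fun k => lmod (x ^ k) (INR k * u)) ks)).
apply (continuous_lsum (fun k u => lmod (x ^ k) (INR k * u))). intros k Hk.
assert (Hy : 0 < x ^ k < 1) by (apply pow_lt_1; auto).
apply (ex_derive_continuous (fun u => lmod (x ^ k) (INR k * u))). unfold lmod. auto_derive.
pose proof (gain_nonneg (x ^ k) (INR k * th)). unfold Rdiv, Rminus in *. simpl in *. lra.
Qed.

Lemma continuous_phase (x : R) (ks : list nat) (th : R) : 0 < x < 1 ->
  (forall k, In k ks -> (1 <= k)%nat) -> continuous (phase x ks) th.
Proof.
intros Hx Hks. unfold phase.
apply (continuous_lsum (fun k u => arg (x ^ k) (INR k * u))). intros k Hk.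
assert (Hy : 0 < x ^ k < 1) by (apply pow_lt_1; auto).
apply (continuous_comp (fun u => INR k * u) (arg (x ^ k))).
- apply (ex_derive_continuous (fun u => INR k * u)). auto_derive; trivial.
- apply (ex_derive_continuous (arg (x ^ k))). eexists. apply is_derive_arg. lra.
Qed.

Lemma continuous_wave (x : R) (ks : list nat) (z : Z) (th : R) : 0 < x < 1 ->
  (forall k, In k ks -> (1 <= k)%nat) -> continuous (wave x ks z) th.
Proof.
intros Hx Hks. unfold wave.
apply (continuous_mult (modulus x ks)); [now apply continuous_modulus |].
apply (continuous_comp (fun u => phase x ks u - IZR z * u) cos).
- apply (continuous_minus (phase x ks)); [now apply continuous_phase |].
  apply (ex_derive_continuous (fun u => IZR z * u)). auto_derive; trivial.
- apply (ex_derive_continuous cos). auto_derive; trivial.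
Qed.

Lemma ex_RInt_wave (x : R) (ks : list nat) (z : Z) (a b : R) : 0 < x < 1 ->
  (forall k, In k ks -> (1 <= k)%nat) -> ex_RInt (wave x ks z) a b.
Proof.
intros Hx Hks. apply (@ex_RInt_continuous R_CompleteNormedModule).
intros th _. now apply continuous_wave.
Qed.

Lemma modulus_le_1 (x : R) (ks : list nat) (th : R) : 0 < x < 1 ->
  (forall k, In k ks -> (1 <= k)%nat) -> modulus x ks th <= 1.
Proof.
intros Hx Hks. unfold modulus. rewrite <- exp_0.
assert (0 <= lsum (fun k => lmod (x ^ k) (INR k * th)) ks).
{ apply lsum_nonneg. intros k Hk. apply lmod_nonneg.
  pose proof (pow_lt_1 x k Hx (Hks k Hk)). lra. }
destruct (Req_dec (lsum (fun k => lmod (x ^ k) (INR k * th)) ks) 0) as [-> |].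
- rewrite Ropp_0. lra.
- apply Rlt_le, exp_increasing. lra.
Qed.

Lemma Rabs_fourier_le (x : R) (ks : list nat) (z : Z) : 0 < x < 1 ->
  (forall k, In k ks -> (1 <= k)%nat) -> Rabs (fourier x ks z) <= PI.
Proof.
intros Hx Hks. pose proof PI_RGT_0. unfold fourier.
replace PI with ((PI - 0) * 1) at 2 by ring.
apply abs_RInt_le_const; [lra | now apply ex_RInt_wave |].
intros th _. unfold wave. rewrite Rabs_mult.
pose proof (modulus_le_1 x ks th Hx Hks). assert (0 < modulus x ks th) by apply exp_pos.
rewrite (Rabs_pos_eq (modulus x ks th)) by lra.
assert (Rabs (cos (phase x ks th - IZR z * th)) <= 1) by (apply Rabs_le, COS_bound).
pose proof (Rabs_pos (cos (phase x ks th - IZR z * th))). nra.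
Qed.

(** [mod_arg_step] integrated over the half circle. The shape is that of [parts_count_cons]: leave
    out the part [k], or use it once and lower the index by [k]. *)
Lemma fourier_cons (x : R) (k : nat) (ks : list nat) (z : Z) : 0 < x < 1 ->
  (forall j, In j (k :: ks) -> (1 <= j)%nat) ->
  fourier x (k :: ks) z
    = x ^ k * fourier x (k :: ks) (z - Z.of_nat k) + (1 - x ^ k) * fourier x ks z.
Proof.
intros Hx Hks.
assert (Hks' : forall j, In j ks -> (1 <= j)%nat) by (intros; apply Hks; now right).
unfold fourier. symmetry.
change (plus (scal (x ^ k) (RInt (wave x (k :: ks) (z - Z.of_nat k)) 0 PI))
  (scal (1 - x ^ k) (RInt (wave x ks z) 0 PI)) = RInt (wave x (k :: ks) z) 0 PI).
rewrite <- !(RInt_scal (V := R_CompleteNormedModule)) by now apply ex_RInt_wave.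
rewrite <- (RInt_plus (V := R_CompleteNormedModule))
  by (apply (ex_RInt_scal (V := R_NormedModule)); now apply ex_RInt_wave).
apply RInt_ext. intros th _.
unfold wave, modulus, phase. cbn [lsum].
set (L := lsum (fun k => lmod (x ^ k) (INR k * th)) ks).
set (P := lsum (fun k => arg (x ^ k) (INR k * th)) ks).
assert (Hy : 0 <= x ^ k < 1) by (pose proof (pow_lt_1 x k Hx (Hks k (or_introl eq_refl))); lra).
pose proof (mod_arg_step (x ^ k) (INR k * th) (P - IZR z * th) Hy) as H.
rewrite Ropp_plus_distr, exp_plus, minus_IZR, <- INR_IZR_INZ.
change (scal ?a ?b) with (a * b). change (plus ?a ?b) with (a + b).
replace (arg (x ^ k) (INR k * th) + P - (IZR z - INR k) * th)
  with (P - IZR z * th + arg (x ^ k) (INR k * th) + INR k * th) by ring.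
replace (arg (x ^ k) (INR k * th) + P - IZR z * th)
  with (P - IZR z * th + arg (x ^ k) (INR k * th)) by ring.
replace ((1 - x ^ k) * (exp (- L) * cos (P - IZR z * th)))
  with (exp (- L) * ((1 - x ^ k) * cos (P - IZR z * th))) by ring.
rewrite <- H. match goal with |- ?a = ?b => change (@eq R a b) end. ring.
Qed.

Lemma fourier_nil (x : R) (z : Z) :
  fourier x nil z = if (z =? 0)%Z then PI else 0.
Proof.
unfold fourier.
rewrite (RInt_ext _ (fun th => cos (IZR z * th))).
2: { intros th _. unfold wave, modulus, phase. simpl.
     rewrite Ropp_0, exp_0, Rmult_1_l, <- cos_neg. f_equal. ring. }
destruct (Z.eqb_spec z 0) as [-> | Hz].
- rewrite (RInt_ext _ (fun _ => 1)) by (intros; rewrite Rmult_0_l; apply cos_0).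
  rewrite RInt_const. change (scal (PI - 0) 1) with ((PI - 0) * 1). ring.
- apply is_RInt_unique.
  assert (Hz' : IZR z <> 0) by now apply not_0_IZR.
  assert (H : is_RInt (fun th => cos (IZR z * th)) 0 PI
    (minus (sin (IZR z * PI) / IZR z) (sin (IZR z * 0) / IZR z))).
  { apply (is_RInt_derive (fun th => sin (IZR z * th) / IZR z)).
    - intros th _. auto_derive; [trivial | now field].
    - intros th _. apply (ex_derive_continuous (fun th => cos (IZR z * th))).
      auto_derive; trivial. }
  rewrite Rmult_0_r, sin_0, (sin_eq_0_1 (IZR z * PI)) in H by now exists z.
  replace (minus (0 / IZR z) (0 / IZR z)) with 0 in H; [exact H |].
  change (0 = 0 / IZR z - 0 / IZR z). ring.
Qed.

(** This is [1 / F (x)]; it appears because [modulus] equals 1 at angle 0. *)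
Definition normalisation (x : R) (ks : list nat) : R :=
  fold_right (fun k c => (1 - x ^ k) * c) 1 ks.

Lemma normalisation_pos (x : R) (ks : list nat) : 0 < x < 1 ->
  (forall k, In k ks -> (1 <= k)%nat) -> 0 < normalisation x ks.
Proof.
intros Hx. induction ks as [| k ks IH]; intros Hks; simpl; [lra |].
apply Rmult_lt_0_compat; [| apply IH; intros; apply Hks; now right].
pose proof (pow_lt_1 x k Hx (Hks k (or_introl eq_refl))). lra.
Qed.

(** At negative indices the factor [k] can be peeled off any number [i] of times, which bounds the
    coefficient by [(x ^ k) ^ i * PI] and so makes it 0. This vanishing starts the strong induction
    that matches [fourier_cons] with [parts_count_cons]. *)
Lemma fourier_spec (x : R) (ks : list nat) : 0 < x < 1 ->
  (forall k, In k ks -> (1 <= k)%nat) ->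
  (forall z, (z < 0)%Z -> fourier x ks z = 0) /\
  (forall n, fourier x ks (Z.of_nat n)
     = PI * normalisation x ks * x ^ n * INR (parts_count ks n)).
Proof.
intros Hx. induction ks as [| k ks IH]; intros Hks.
- split; intros z; rewrite fourier_nil.
  + intros Hz. destruct (Z.eqb_spec z 0); [lia | reflexivity].
  + destruct z as [| z]; simpl; ring.
- assert (Hks' : forall j, In j ks -> (1 <= j)%nat) by (intros; apply Hks; now right).
  destruct (IH Hks') as [IHneg IHpos].
  assert (Hk : (1 <= k)%nat) by (apply Hks; now left).
  assert (Hy := pow_lt_1 x k Hx Hk).
  assert (Hneg : forall z, (z < 0)%Z -> fourier x (k :: ks) z = 0).
  { intros z Hz.
    assert (Hi : forall i z, (z < 0)%Z -> Rabs (fourier x (k :: ks) z) <= (x ^ k) ^ i * PI).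
    { clear z Hz. induction i as [| i IHi]; intros z Hz.
      - simpl. rewrite Rmult_1_l. now apply Rabs_fourier_le.
      - rewrite fourier_cons, (IHneg z), Rmult_0_r, Rplus_0_r, Rabs_mult by assumption.
        rewrite (Rabs_pos_eq (x ^ k)) by lra. simpl. rewrite Rmult_assoc.
        apply Rmult_le_compat_l; [lra |]. apply IHi. lia. }
    assert (Hl : Rbar_le (Rabs (fourier x (k :: ks) z)) 0).
    { apply (is_lim_seq_le (fun _ => Rabs (fourier x (k :: ks) z)) (fun i => (x ^ k) ^ i * PI)).
      - intros i. now apply Hi.
      - apply is_lim_seq_const.
      - replace (Finite 0) with (Finite (0 * PI)) by (f_equal; ring).
        apply (is_lim_seq_mult' (fun i => (x ^ k) ^ i) (fun _ => PI));
          [| apply is_lim_seq_const]. apply is_lim_seq_geom. rewrite Rabs_pos_eq; lra. }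
    simpl in Hl. pose proof (Rabs_pos (fourier x (k :: ks) z)).
    apply Rabs_eq_0. lra. }
  split; [exact Hneg |].
  intros n. induction n as [n IHn] using lt_wf_ind.
  rewrite fourier_cons, IHpos, parts_count_cons, plus_INR by assumption.
  destruct (Nat.leb_spec k n) as [Hle | Hlt].
  + rewrite <- Nat2Z.inj_sub by assumption. rewrite IHn by lia.
    replace (x ^ n) with (x ^ k * x ^ (n - k)) by (rewrite <- pow_add; f_equal; lia).
    simpl normalisation. ring.
  + rewrite Hneg by lia. simpl. ring.
Qed.

(* AM-GM: [2 q n > q (n - 1) / x + x q (n + 1)] already gives strict log-concavity at [n], and
   up to a positive factor the difference of the two sides is the integral below. *)
Lemma log_concave_of_integral_pos (x : R) (ks : list nat) (n : nat) : 0 < x < 1 ->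
  (forall k, In k ks -> (1 <= k)%nat) -> (1 <= n)%nat ->
  0 < RInt (fun th => wave x ks (Z.of_nat n) th * (1 - cos th)) 0 PI ->
  (parts_count ks (n - 1) * parts_count ks (n + 1) < parts_count ks n * parts_count ks n)%nat.
Proof.
intros Hx Hks Hn HI.
destruct (fourier_spec x ks Hx Hks) as [_ Hf].
assert (Hex : forall z, ex_RInt (wave x ks z) 0 PI) by (intros; now apply ex_RInt_wave).
assert (HS : 2 * RInt (fun th => wave x ks (Z.of_nat n) th * (1 - cos th)) 0 PI
  = 2 * fourier x ks (Z.of_nat n)
    - (fourier x ks (Z.of_nat (n - 1)) + fourier x ks (Z.of_nat (n + 1)))).
{ unfold fourier.
  change (scal 2 (RInt (fun th => wave x ks (Z.of_nat n) th * (1 - cos th)) 0 PI)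
    = minus (scal 2 (RInt (wave x ks (Z.of_nat n)) 0 PI))
      (plus (RInt (wave x ks (Z.of_nat (n - 1))) 0 PI)
            (RInt (wave x ks (Z.of_nat (n + 1))) 0 PI))).
  rewrite <- (RInt_plus (V := R_CompleteNormedModule)) by apply Hex.
  rewrite <- (RInt_scal (V := R_CompleteNormedModule) (wave x ks (Z.of_nat n))) by apply Hex.
  rewrite <- (RInt_minus (V := R_CompleteNormedModule)).
  2: apply (ex_RInt_scal (V := R_NormedModule)), Hex.
  2: apply (ex_RInt_plus (V := R_NormedModule)); apply Hex.
  rewrite <- (RInt_scal (V := R_CompleteNormedModule)).
  2: { apply (@ex_RInt_continuous R_CompleteNormedModule). intros th _.
       apply (continuous_mult (wave x ks (Z.of_nat n))); [now apply continuous_wave |].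
       apply (ex_derive_continuous (fun th => 1 - cos th)). auto_derive; trivial. }
  apply RInt_ext. intros th _.
  change (2 * (wave x ks (Z.of_nat n) th * (1 - cos th)) = 2 * wave x ks (Z.of_nat n) th
    - (wave x ks (Z.of_nat (n - 1)) th + wave x ks (Z.of_nat (n + 1)) th)).
  unfold wave. rewrite <- !INR_IZR_INZ, minus_INR, plus_INR by assumption. simpl (INR 1).
  set (B := phase x ks th).
  replace (B - (INR n - 1) * th) with (B - INR n * th + th) by ring.
  replace (B - (INR n + 1) * th) with (B - INR n * th - th) by ring.
  rewrite (cos_plus (B - INR n * th)), (cos_minus (B - INR n * th)). ring. }
rewrite !Hf in HS.
assert (Hc := normalisation_pos x ks Hx Hks). pose proof PI_RGT_0.
set (q0 := parts_count ks (n - 1)) in *. set (q1 := parts_count ks n) in *.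
set (q2 := parts_count ks (n + 1)) in *.
replace (x ^ n) with (x ^ (n - 1) * x) in HS
  by (replace n with (S (n - 1)) at 2 by lia; rewrite <- tech_pow_Rmult; ring).
replace (x ^ (n + 1)) with (x ^ (n - 1) * x ^ 2) in HS
  by (rewrite <- pow_add; f_equal; lia).
assert (Hp : 0 < PI * normalisation x ks * x ^ (n - 1))
  by (apply Rmult_lt_0_compat; [nra | now apply pow_lt]).
set (p := PI * normalisation x ks * x ^ (n - 1)) in *.
assert (H2 : 0 < p * (2 * x * INR q1 - (INR q0 + x ^ 2 * INR q2))).
{ unfold p in *. nra. }
assert (H3 : INR q0 + x ^ 2 * INR q2 < 2 * x * INR q1).
{ destruct (Rle_lt_dec (2 * x * INR q1 - (INR q0 + x ^ 2 * INR q2)) 0); [nra | lra]. }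
apply INR_lt. rewrite !mult_INR.
assert (0 <= INR q0) by apply pos_INR. assert (0 <= INR q2) by apply pos_INR.
assert (0 <= INR q1) by apply pos_INR.
assert (Hx2 : 0 < x ^ 2) by now apply pow_lt.
assert (0 <= x ^ 2 * INR q2) by (apply Rmult_le_pos; lra).
assert (Hsq : (INR q0 + x ^ 2 * INR q2) ^ 2 < (2 * x * INR q1) ^ 2)
  by (simpl; nra).
pose proof (pow2_ge_0 (INR q0 - x ^ 2 * INR q2)).
apply Rmult_lt_reg_l with (4 * x ^ 2); [lra |]. nra.
Qed.

(** * Bounds for the integrand *)

Lemma exp_le_exp (a b : R) : a <= b -> exp a <= exp b.
Proof.
intros [H | ->]; [apply Rlt_le, exp_increasing, H | lra].
Qed.

Lemma modulus_ge (t th : R) (N : nat) : 0 < t ->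
  exp (- (33 / 20 / t ^ 3 * th ^ 2)) <= modulus (exp (- t)) (seq 2 N) th.
Proof.
intros Ht. pose proof (exp_opp_lt_1 t Ht) as Hx.
unfold modulus. apply exp_le_exp, Ropp_le_contravar.
apply Rle_trans with (lsum (fun k => th ^ 2 / 2 *
  (INR k ^ 2 * (exp (- t) ^ k / (1 - exp (- t) ^ k) ^ 2))) (seq 2 N)).
- apply lsum_le. intros k Hk.
  pose proof (pow_lt_1 (exp (- t)) k Hx (In_seq2_ge1 N k Hk)) as Hy.
  eapply Rle_trans; [apply lmod_le; lra |]. right. field. lra.
- rewrite lsum_scal. pose proof (variance_le t N Ht). pose proof (pow2_ge_0 th).
  replace (33 / 20 / t ^ 3 * th ^ 2) with (th ^ 2 / 2 * (33 / 10 / t ^ 3)) by (field; lra).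
  apply Rmult_le_compat_l; lra.
Qed.

(** Subtracting the mean cancels the linear term of the phase; the rest is a sixth of the third
    cumulant bound, [1023 / 600 = 341 / 200]. *)
Lemma phase_le (t th m : R) (N : nat) : 0 < t -> 0 <= th ->
  lsum (fun k => INR k * (exp (- t) ^ k / (1 - exp (- t) ^ k))) (seq 2 N) = m ->
  Rabs (phase (exp (- t)) (seq 2 N) th - m * th) <= 341 / 200 / t ^ 4 * th ^ 3.
Proof.
intros Ht Hth <-. pose proof (exp_opp_lt_1 t Ht) as Hx.
unfold phase. rewrite (Rmult_comm _ th), <- lsum_scal.
replace (lsum _ _ - _) with (lsum (fun k => arg (exp (- t) ^ k) (INR k * th)
  - INR k * th * (exp (- t) ^ k / (1 - exp (- t) ^ k))) (seq 2 N)).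
2: { rewrite (lsum_ext _ (fun k => arg (exp (- t) ^ k) (INR k * th)
       + -1 * (th * (INR k * (exp (- t) ^ k / (1 - exp (- t) ^ k)))))) by (intros; ring).
     rewrite lsum_plus, lsum_scal. ring. }
eapply Rle_trans; [apply Rabs_lsum_le |].
apply Rle_trans with (lsum (fun k => th ^ 3 / 6 *
  (INR k ^ 3 * (exp (- t) ^ k * (1 + exp (- t) ^ k) / (1 - exp (- t) ^ k) ^ 3))) (seq 2 N)).
- apply lsum_le. intros k Hk.
  pose proof (pow_lt_1 (exp (- t)) k Hx (In_seq2_ge1 N k Hk)) as Hy.
  eapply Rle_trans.
  + apply arg_cubic; [lra |]. apply Rmult_le_pos; [apply pos_INR | assumption].
  + right. field. lra.
- rewrite lsum_scal. pose proof (third_cumulant_le t N Ht).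
  assert (0 <= th ^ 3) by now apply pow_le.
  replace (341 / 200 / t ^ 4 * th ^ 3) with (th ^ 3 / 6 * (1023 / 100 / t ^ 4)) by (field; lra).
  apply Rmult_le_compat_l; lra.
Qed.

(* [cos_tail x th a] is [sum_(k >= a) x ^ k (1 - cos (k th))]. *)
Definition cos_tail (x th : R) (a : nat) : R :=
  x ^ a * (1 / (1 - x)
    - (cos (INR a * th) - x * cos ((INR a - 1) * th)) / (1 - 2 * x * cos th + x ^ 2)).

Lemma lsum_cos_tail (x th : R) (a N : nat) : 0 < x < 1 ->
  lsum (fun k => x ^ k * (1 - cos (INR k * th))) (seq a N)
    = cos_tail x th a - cos_tail x th (a + N).
Proof.
intros Hx. pose proof (norm_sqr_pos x th ltac:(lra)) as Hd.
revert a. induction N as [| N IH]; intros a; cbn [seq lsum].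
- rewrite Nat.add_0_r. ring.
- rewrite IH, Nat.add_succ_r.
  assert (Hstep : cos_tail x th a = x ^ a * (1 - cos (INR a * th)) + cos_tail x th (S a));
    [| simpl in *; lra].
  unfold cos_tail. rewrite S_INR. simpl (x ^ S a).
  replace ((INR a - 1) * th) with (INR a * th - th) by ring.
  replace ((INR a + 1) * th) with (INR a * th + th) by ring.
  replace (INR a * th + th - th) with (INR a * th) by ring.
  replace ((INR a + 1 - 1) * th) with (INR a * th) by ring.
  rewrite cos_plus, cos_minus. field. lra.
Qed.

Lemma Rabs_cos_tail_le (x th : R) (a : nat) : 0 < x < 1 ->
  Rabs (cos_tail x th a) <= 3 * x ^ a / (1 - x) ^ 2.
Proof.
intros Hx. pose proof (norm_sqr_pos x th ltac:(lra)) as Hd. unfold cos_tail.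
assert (Hxa : 0 < x ^ a) by (apply pow_lt; lra).
rewrite Rabs_mult, (Rabs_pos_eq (x ^ a)) by lra.
replace (3 * x ^ a / (1 - x) ^ 2) with (x ^ a * (3 / (1 - x) ^ 2)) by (field; lra).
apply Rmult_le_compat_l; [lra |].
assert (H1 : 0 < 1 / (1 - x) <= 1 / (1 - x) ^ 2).
{ split; [apply Rdiv_lt_0_compat; lra |]. unfold Rdiv. rewrite !Rmult_1_l.
  apply Rinv_le_contravar; [apply pow_lt |]; nra. }
assert (H2 : Rabs ((cos (INR a * th) - x * cos ((INR a - 1) * th)) / (1 - 2 * x * cos th + x ^ 2))
   <= 2 / (1 - x) ^ 2).
{ unfold Rdiv. rewrite Rabs_mult, (Rabs_pos_eq (/ _)) by (apply Rlt_le, Rinv_0_lt_compat; lra).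
  apply Rmult_le_compat; [apply Rabs_pos | apply Rlt_le, Rinv_0_lt_compat; lra | |].
  - pose proof (COS_bound (INR a * th)). pose proof (COS_bound ((INR a - 1) * th)).
    apply Rabs_le. nra.
  - pose proof (COS_bound th). apply Rinv_le_contravar; [apply pow_lt |]; nra. }
apply Rabs_le. apply Rabs_le_between in H2. lra.
Qed.

(** The right-hand side is [coth (t / 2)], so this is [tanh u <= u] at [u = t / 2]. *)
Lemma two_div_le_coth (t : R) : 0 < t -> 2 / t <= (1 + exp (- t)) / (1 - exp (- t)).
Proof.
intros Ht. pose proof (exp_opp_lt_1 t Ht).
assert (Hm : 2 * (1 - exp (- t)) <= t * (1 + exp (- t))).
{ assert (H0 := le_of_derive_nonneg (fun s => s * (1 + exp (- s)) - 2 * (1 - exp (- s)))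
    (fun s => 1 - (1 + s) * exp (- s)) 0 t (Rlt_le _ _ Ht)).
  cbv beta in H0. rewrite Ropp_0, exp_0 in H0.
  assert (0 * (1 + 1) - 2 * (1 - 1) <= t * (1 + exp (- t)) - 2 * (1 - exp (- t)));
    [apply H0 | lra].
  - intros s _. auto_derive; [trivial | ring].
  - intros s Hs. pose proof (exp_ineq1_le s). pose proof (exp_pos (- s)).
    assert (exp (- s) * exp s = 1) by (rewrite <- exp_plus, Rplus_opp_l; apply exp_0). nra. }
apply Rmult_le_reg_r with (t * (1 - exp (- t))); [apply Rmult_lt_0_compat; lra |].
replace (2 / t * (t * (1 - exp (- t)))) with (2 * (1 - exp (- t))) by (field; lra).
replace ((1 + exp (- t)) / (1 - exp (- t)) * (t * (1 - exp (- t)))) with (t * (1 + exp (- t)))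
  by (field; lra).
exact Hm.
Qed.

(** Squaring the previous bound, with [coth (t / 2) ^ 2 = 1 + 4 / D], gives
    [D <= 4 t ^ 2 / (4 - t ^ 2)]; for [t <= 1 / 32] the quotient by [t ^ 2] stays below 1.0003. *)
Lemma dcosh_le (t : R) : 0 < t <= 1 / 32 -> dcosh t <= 1.0003 * t ^ 2.
Proof.
intros Ht. pose proof (exp_opp_lt_1 t (proj1 Ht)) as Hx.
pose proof (two_div_le_coth t (proj1 Ht)) as Hc.
pose proof (one_sub_exp_opp_sqr t) as Hsq.
set (x := exp (- t)) in *. set (D := dcosh t) in *.
assert (0 < (1 - x) ^ 2) by (apply pow_lt; lra). assert (HD : 0 < D) by nra.
assert (Hc2 : (2 / t) ^ 2 <= ((1 + x) / (1 - x)) ^ 2)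
  by (apply pow_incr; split; [apply Rdiv_le_0_compat; lra | assumption]).
replace (((1 + x) / (1 - x)) ^ 2) with (1 + 4 * x / (1 - x) ^ 2) in Hc2 by (field; lra).
rewrite Hsq in Hc2. replace (4 * x / (x * D)) with (4 / D) in Hc2 by (field; lra).
assert (Ht2 : 0 < t ^ 2 <= 1 / 1024) by (split; [apply pow_lt; lra | nra]).
assert (H4 : D * (4 - t ^ 2) <= 4 * t ^ 2).
{ apply Rmult_le_reg_r with (/ (t ^ 2 * D)); [apply Rinv_0_lt_compat; nra |].
  replace (D * (4 - t ^ 2) * / (t ^ 2 * D)) with ((2 / t) ^ 2 - 1) by (field; lra).
  replace (4 * t ^ 2 * / (t ^ 2 * D)) with (4 / D) by (field; lra). lra. }
nra.
Qed.

(** By [lmod_ge] the exponent is controlled by [sum_k x ^ k (1 - cos (k th))], whose full sum over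
    [k >= 1] is [coth (t / 2) / 2 * (2 v / (D + 2 v))] with [v = 1 - cos th]. Leaving out [k = 1]
    costs at most [1 - cos th], truncation at most [1 / 1000]. *)
Lemma modulus_le (t th : R) (N : nat) : 0 < t <= 1 / 32 ->
  3 * exp (- t) ^ (2 + N) / (1 - exp (- t)) ^ 2 <= 1 / 1000 ->
  modulus (exp (- t)) (seq 2 N) th <=
    exp (- (1 / t * (2 * (1 - cos th) / (1.0003 * t ^ 2 + 2 * (1 - cos th))))
         + (1 - cos th) + 1 / 1000).
Proof.
intros Ht HN. pose proof (exp_opp_lt_1 t (proj1 Ht)) as Hx.
pose proof (two_div_le_coth t (proj1 Ht)) as Hc. pose proof (dcosh_le t Ht) as HD.
pose proof (one_sub_exp_opp_sqr t) as Hsq. pose proof (COS_bound th) as Hcos.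
pose proof (norm_sqr_pos (exp (- t)) th ltac:(lra)) as Hd.
pose proof (Rabs_cos_tail_le (exp (- t)) th (2 + N) Hx) as Htail.
apply Rabs_le_between in Htail.
pose proof (lsum_cos_tail (exp (- t)) th 2 N Hx) as Hsum.
pose proof (lsum_cos_tail (exp (- t)) th 1 1 Hx) as Hsum1.
simpl (seq 1 1) in Hsum1. cbn [lsum] in Hsum1. simpl (1 + 1)%nat in Hsum1.
rewrite pow_1, Rplus_0_r in Hsum1. simpl (INR 1) in Hsum1. rewrite Rmult_1_l in Hsum1.
assert (HE : 1 / t * (2 * (1 - cos th) / (1.0003 * t ^ 2 + 2 * (1 - cos th)))
  <= cos_tail (exp (- t)) th 1).
{ unfold cos_tail. simpl (INR 1). rewrite Rmult_1_l.
  replace ((1 - 1) * th) with 0 by ring. rewrite cos_0.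
  set (x := exp (- t)) in *. set (D := dcosh t) in *. set (v := 1 - cos th) in *.
  assert (Hv : 0 <= v <= 2) by (unfold v; lra).
  replace (cos th) with (1 - v) in * by (unfold v; ring).
  assert (0 < (1 - x) ^ 2) by (apply pow_lt; lra). assert (HDp : 0 < D) by nra.
  replace (1 - 2 * x * (1 - v) + x ^ 2) with (x * (D + 2 * v)) by (ring_simplify; nra).
  replace (x ^ 1 * (1 / (1 - x) - (1 - v - x * 1) / (x * (D + 2 * v))))
    with ((1 + x) / (1 - x) / 2 * (2 * v / (D + 2 * v))).
  2: { assert (HDx : D = (1 - x) ^ 2 / x) by (rewrite Hsq; field; lra).
       rewrite HDx. field. repeat split; lra. }
  apply Rmult_le_compat.
  - apply Rlt_le, Rdiv_lt_0_compat; lra.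
  - apply Rdiv_le_0_compat; [lra |]. assert (0 < t ^ 2) by (apply pow_lt; lra). lra.
  - replace (1 / t) with (2 / t / 2) by (field; lra). lra.
  - apply Rmult_le_compat_l; [lra |]. apply Rinv_le_contravar; lra. }
unfold modulus. apply exp_le_exp.
assert (Hl : lsum (fun k => exp (- t) ^ k * (1 - cos (INR k * th))) (seq 2 N)
  <= lsum (fun k => lmod (exp (- t) ^ k) (INR k * th)) (seq 2 N)).
{ apply lsum_le. intros k Hk.
  pose proof (pow_lt_1 (exp (- t)) k Hx (In_seq2_ge1 N k Hk)) as Hy. apply lmod_ge. lra. }
assert (exp (- t) * (1 - cos th) <= 1 - cos th) by nra.
lra.
Qed.

(** Comparison after the substitution [u = d v], proved by differentiating in the upper limit. Only
    an explicit primitive [g] of the lower bound is required, and no integral of the bound is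
    formed. *)
Lemma RInt_ge_of_derive (f g g' : R -> R) (d c a b : R) : 0 < d -> a <= b ->
  (forall u, continuous f u) ->
  (forall v, a <= v <= b -> is_derive g v (g' v)) ->
  (forall v, a <= v <= b -> c * g' v <= f (d * v)) ->
  d * c * (g b - g a) <= RInt f (d * a) (d * b).
Proof.
intros Hd Hab Hf Hg Hle.
assert (Hex : forall u w, ex_RInt f u w)
  by (intros; apply (@ex_RInt_continuous R_CompleteNormedModule); intros; apply Hf).
assert (H := le_of_derive_nonneg (fun v => RInt f (d * a) (d * v) - d * c * g v)
  (fun v => d * f (d * v) - d * c * g' v) a b Hab).
cbv beta in H.
replace (RInt f (d * a) (d * a)) with 0 in H by (symmetry; apply (RInt_point (V := R_CompleteNormedModule))).
assert (0 - d * c * g a <= RInt f (d * a) (d * b) - d * c * g b); [apply H | lra].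
- intros v Hv. apply (is_derive_minus (fun v => RInt f (d * a) (d * v)) (fun v => d * c * g v)).
  + apply (is_derive_comp (fun u => RInt f (d * a) u) (fun v => d * v)).
    * apply (is_derive_RInt f (fun u => RInt f (d * a) u) (d * a) (d * v)); [| apply Hf].
      exists (mkposreal 1 Rlt_0_1). intros u _. apply (RInt_correct (V := R_CompleteNormedModule)), Hex.
    * auto_derive; [trivial | ring].
  + apply (is_derive_scal g v (d * c)). now apply Hg.
- intros v Hv. specialize (Hle v Hv).
  assert (d * (c * g' v) <= d * f (d * v)) by (apply Rmult_le_compat_l; lra). lra.
Qed.

Lemma exp_mul_INR (n : nat) (u : R) : exp (INR n * u) = exp u ^ n.
Proof.
induction n as [| n IH]; [simpl; rewrite Rmult_0_l; apply exp_0 |].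
rewrite S_INR, Rmult_plus_distr_r, exp_plus, IH, Rmult_1_l. simpl. ring.
Qed.

Lemma exp_1_ge : 2.716 <= exp 1.
Proof.
replace 1 with (INR 4 * (1 / 4)) by (simpl; field). rewrite exp_mul_INR.
apply Rle_trans with (1.2838 ^ 4); [lra |]. apply pow_incr.
pose proof (exp_ge_cubic (1 / 4) ltac:(lra)). lra.
Qed.

Lemma one_sub_cos_ge (th c : R) : 0 <= th -> th ^ 2 <= 12 * (1 - 2 * c) -> c * th ^ 2 <= 1 - cos th.
Proof.
intros Hth Hs. pose proof (one_sub_cos_ge_quartic th Hth). pose proof (pow2_ge_0 th).
assert (0 <= th ^ 2 * (12 * (1 - 2 * c) - th ^ 2)) by (apply Rmult_le_pos; lra).
replace (th ^ 4) with (th ^ 2 * th ^ 2) in H by ring. lra.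
Qed.

(** * The saddle-point integral: central, middle, near and far arcs *)

Section Saddle.

Variables (t : R) (N n : nat).
Hypothesis Ht : 0 < t <= 1 / 32.
Hypothesis saddle :
  lsum (fun k => INR k * (exp (- t) ^ k / (1 - exp (- t) ^ k))) (seq 2 N) = INR n.
Hypothesis truncation : 3 * exp (- t) ^ (2 + N) / (1 - exp (- t)) ^ 2 <= 1 / 1000.

Let integrand (th : R) : R := wave (exp (- t)) (seq 2 N) (Z.of_nat n) th * (1 - cos th).
(** The natural angular width [t ^ (3/2)]: the variance is of order [t ^ (-3)], so with
    [th = scale * v] the Gaussian factor becomes [exp (- 33/20 v ^ 2)], free of [t]. *)
Let scale : R := t * sqrt t.

Lemma continuous_integrand (th : R) : continuous integrand th.
Proof.
pose proof (exp_opp_lt_1 t (proj1 Ht)).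
apply (continuous_mult (wave (exp (- t)) (seq 2 N) (Z.of_nat n))).
- apply continuous_wave; [assumption | apply In_seq2_ge1].
- apply (ex_derive_continuous (fun th => 1 - cos th)). auto_derive; trivial.
Qed.

Lemma integrand_ge_opp (th : R) :
  - ((1 - cos th) * modulus (exp (- t)) (seq 2 N) th) <= integrand th.
Proof.
unfold integrand, wave.
set (m := modulus _ _ _). assert (Hm : 0 < m) by apply exp_pos.
set (w := phase _ _ _ - _). pose proof (COS_bound th). pose proof (COS_bound w).
assert (0 <= (1 - cos th) * m) by (apply Rmult_le_pos; lra). nra.
Qed.

Lemma scale_sqr : scale ^ 2 = t ^ 3.
Proof. unfold scale. rewrite Rpow_mult_distr, pow2_sqrt by lra. ring. Qed.

Lemma scale_pos : 0 < scale.
Proof. apply Rmult_lt_0_compat; [lra | apply sqrt_lt_R0; lra]. Qed.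

(** After scaling, the phase is at most [1.705 sqrt t v ^ 3], so for [t <= 1 / 32] its cosine is at
    least [1 - 0.0455 v ^ 6]. The cut at [v = 8 / 5] keeps this positive, which allows the lower
    bounds of the three factors to be multiplied. *)
Lemma integrand_central (v : R) : 0 <= v <= 8 / 5 ->
  0.4999 * scale ^ 2 * ((v ^ 2 - 0.0455 * v ^ 8) * exp (- (33 / 20 * v ^ 2)))
  <= integrand (scale * v).
Proof.
intros Hv. pose proof scale_sqr as Hs. pose proof scale_pos as Hp.
assert (Hth : 0 <= scale * v) by (apply Rmult_le_pos; lra).
assert (Hm := modulus_ge t (scale * v) N (proj1 Ht)).
replace (33 / 20 / t ^ 3 * (scale * v) ^ 2) with (33 / 20 * v ^ 2) in Hm
  by (rewrite Rpow_mult_distr, Hs; field; lra).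
assert (Hph := phase_le t (scale * v) (INR n) N (proj1 Ht) Hth saddle).
replace (341 / 200 / t ^ 4 * (scale * v) ^ 3) with (341 / 200 * (sqrt t * v ^ 3)) in Hph.
2: { replace ((scale * v) ^ 3) with (scale ^ 2 * scale * v ^ 3) by ring.
     rewrite Hs. unfold scale. field. lra. }
unfold integrand, wave. rewrite <- INR_IZR_INZ.
set (m := modulus _ _ _) in *. set (w := phase _ _ _ - _) in *. set (E := exp (- (33 / 20 * v ^ 2))) in *.
assert (HE : 0 < E) by apply exp_pos.
assert (Ht3 : 0 < t ^ 3 <= 1 / 32768).
{ split; [apply pow_lt; lra |]. replace (1 / 32768) with ((1 / 32) ^ 3) by field.
  apply pow_incr. lra. }
assert (Hv2 : 0 <= v ^ 2 <= 64 / 25) by (split; [apply pow2_ge_0 | nra]).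
assert (Hv6 : 0 <= v ^ 6 <= 17).
{ replace (v ^ 6) with ((v ^ 2) ^ 3) by ring. split; [apply pow_le; lra |].
  apply Rle_trans with ((64 / 25) ^ 3); [apply pow_incr; lra | lra]. }
assert (Hcos : 1 - 0.0455 * v ^ 6 <= cos w).
{ pose proof (one_sub_cos_le_half_sqr w).
  assert (Hw : w ^ 2 <= (341 / 200 * (sqrt t * v ^ 3)) ^ 2).
  { rewrite <- (pow2_abs w). apply pow_incr. split; [apply Rabs_pos | assumption]. }
  replace ((341 / 200 * (sqrt t * v ^ 3)) ^ 2) with ((341 / 200) ^ 2 * t * v ^ 6) in Hw.
  2: { rewrite !Rpow_mult_distr, pow2_sqrt by lra. ring. }
  assert (t * v ^ 6 <= 1 / 32 * v ^ 6) by (apply Rmult_le_compat_r; lra). lra. }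
assert (Hone : 0.4999 * (scale * v) ^ 2 <= 1 - cos (scale * v)).
{ apply one_sub_cos_ge; [assumption |]. rewrite Rpow_mult_distr, Hs. nra. }
rewrite Rpow_mult_distr in Hone.
assert (H0 : 0 <= 0.4999 * (scale ^ 2 * v ^ 2))
  by (apply Rmult_le_pos; [lra | rewrite Hs; apply Rmult_le_pos; lra]).
assert (H1 : E * (1 - 0.0455 * v ^ 6) <= m * cos w)
  by (apply Rmult_le_compat; lra).
assert (H2 : 0 <= E * (1 - 0.0455 * v ^ 6)) by (apply Rmult_le_pos; lra).
replace (0.4999 * scale ^ 2 * ((v ^ 2 - 0.0455 * v ^ 8) * E))
  with (E * (1 - 0.0455 * v ^ 6) * (0.4999 * (scale ^ 2 * v ^ 2))) by ring.
apply Rmult_le_compat; lra.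
Qed.

(* The polynomial truncates the series of an antiderivative of [(v^2 - 0.0455 v^8) exp (-1.65 v^2)],
   with coefficients rounded down. *)
Lemma central_integral : 0.084 * scale ^ 3 <= RInt integrand (scale * 0) (scale * (8 / 5)).
Proof.
pose proof scale_pos as Hp.
set (P := fun v : R => v ^ 3 / 3 + 11 / 50 * v ^ 5 + 1037 / 10000 * v ^ 7 + 329 / 10000 * v ^ 9
  + 98 / 10000 * v ^ 11 + 248 / 100000 * v ^ 13).
set (P' := fun v : R => v ^ 2 + 11 / 10 * v ^ 4 + 7259 / 10000 * v ^ 6 + 2961 / 10000 * v ^ 8
  + 1078 / 10000 * v ^ 10 + 3224 / 100000 * v ^ 12).
assert (H := RInt_ge_of_derive integrand (fun v => P v * exp (- (33 / 20 * v ^ 2)))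
  (fun v => (P' v - 33 / 10 * v * P v) * exp (- (33 / 20 * v ^ 2))) scale (0.4999 * scale ^ 2) 0 (8 / 5)
  Hp ltac:(lra) continuous_integrand).
cbv beta in H.
eapply Rle_trans; [| apply H].
(* The exponent is [4.224 = 16 / 4 + 28 / 125], cut into pieces small enough for the cubic Taylor
   bound to be accurate. *)
- assert (HE : 0.01457 <= exp (- (33 / 20 * (8 / 5) ^ 2))).
  { replace (- (33 / 20 * (8 / 5) ^ 2)) with (INR 16 * - (1 / 4) + - (28 / 125)) by (simpl INR; lra).
    rewrite exp_plus, exp_mul_INR.
    apply Rle_trans with (0.7786 ^ 16 * 0.7992); [lra |].
    apply Rmult_le_compat; [lra | lra | |].
    - apply pow_incr. pose proof (exp_opp_ge_cubic (1 / 4) ltac:(lra)). lra.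
    - pose proof (exp_opp_ge_cubic (28 / 125) ltac:(lra)). lra. }
  assert (HP : 11.55 <= P (8 / 5)) by (unfold P; lra).
  assert (HP0 : P 0 = 0) by (unfold P; lra).
  rewrite HP0.
  assert (11.55 * 0.01457 <= P (8 / 5) * exp (- (33 / 20 * (8 / 5) ^ 2)))
    by (apply Rmult_le_compat; lra).
  assert (0 < scale ^ 3) by now apply pow_lt.
  replace (scale * (0.4999 * scale ^ 2) * (P (8 / 5) * exp (- (33 / 20 * (8 / 5) ^ 2))
    - 0 * exp (- (33 / 20 * 0 ^ 2)))) with
    (scale ^ 3 * (0.4999 * (P (8 / 5) * exp (- (33 / 20 * (8 / 5) ^ 2))))) by ring.
  rewrite Rmult_comm. apply Rmult_le_compat_l; lra.
- intros v _. unfold P, P'. auto_derive; [trivial |].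
  change (v * (v * 1)) with (v ^ 2). field.
- intros v Hv. eapply Rle_trans; [| apply integrand_central, Hv].
  apply Rmult_le_compat_l; [pose proof (pow2_ge_0 scale); lra |].
  apply Rmult_le_compat_r; [apply Rlt_le, exp_pos |]. unfold P, P'.
  (* The surplus of [v ^ 2 - 0.0455 v ^ 8] over [P' v - 3.3 v P v] is a combination of even powers
     of [v] with nonnegative coefficients. *)
  assert (Hk : forall k, 0 <= v ^ k) by (intros; apply pow_le; lra).
  pose proof (Hk 4%nat). pose proof (Hk 6%nat). pose proof (Hk 8%nat).
  pose proof (Hk 10%nat). pose proof (Hk 12%nat). pose proof (Hk 14%nat). lra.
Qed.

(* The function [v^2 / (1 + v^2 / 32)] lies above its tangent line at [8 / 5] (rounded down) as
   long as [v^2 <= 32]. *)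
Lemma exponent_ge_linear (v : R) : 8 / 5 <= v -> t * v ^ 2 <= 1 ->
  2.37 + 2.74 * (v - 8 / 5) <= v ^ 2 / (1 + t * v ^ 2).
Proof.
intros Hv Htv. set (l := 2.37 + 2.74 * (v - 8 / 5)).
assert (Hl : 0 < l) by (unfold l; lra).
assert (Hv2 : 0 < v ^ 2) by (apply pow_lt; lra).
assert (Htv0 : 0 < t * v ^ 2) by nra.
apply Rmult_le_reg_r with (1 + t * v ^ 2); [lra |].
replace (v ^ 2 / (1 + t * v ^ 2) * (1 + t * v ^ 2)) with (v ^ 2) by (field; lra).
destruct (Rle_dec (v ^ 2) 32) as [H32 | H32].
- assert (Hv6 : v <= 5.66) by nra.
  assert (l * (1 + t * v ^ 2) <= l * (1 + 1 / 32 * v ^ 2)) by (apply Rmult_le_compat_l; nra).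
  assert (Hc : l * (1 + 1 / 32 * v ^ 2) <= v ^ 2); [| lra].
  unfold l. set (u := v - 8 / 5). replace v with (u + 8 / 5) by (unfold u; ring).
  assert (Hu : 0 <= u <= 4.06) by (unfold u; lra).
  assert (0 <= u ^ 2 * (4.06 - u)) by (apply Rmult_le_pos; [apply pow2_ge_0 | lra]).
  pose proof (pow2_ge_0 u). lra.
(* Past the range of the tangent line, [t v ^ 2 <= 1] bounds the denominator by 2, and [v ^ 2 / 2]
   lies above the line. *)
- assert (Hv5 : 5.65 <= v) by nra.
  assert (l * (1 + t * v ^ 2) <= l * 2) by (apply Rmult_le_compat_l; lra).
  unfold l in *. nra.
Qed.

(** The gain in [modulus_le] increases with [2 (1 - cos th)], so a lower bound for the latter in
    units of [t ^ 2] suffices. *)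
Lemma gain_ge (th c : R) : 0 <= c -> c * t ^ 2 <= 2 * (1 - cos th) ->
  1 / t * (c / (1.0003 + c))
    <= 1 / t * (2 * (1 - cos th) / (1.0003 * t ^ 2 + 2 * (1 - cos th))).
Proof.
intros Hc H. assert (Ht2 : 0 < t ^ 2) by (apply pow_lt; lra).
assert (0 <= c * t ^ 2) by nra.
apply Rmult_le_compat_l; [apply Rlt_le, Rdiv_lt_0_compat; lra |].
set (w := 2 * (1 - cos th)) in *.
apply Rmult_le_reg_r with ((1.0003 + c) * (1.0003 * t ^ 2 + w)); [apply Rmult_lt_0_compat; lra |].
replace (c / (1.0003 + c) * ((1.0003 + c) * (1.0003 * t ^ 2 + w)))
  with (c * (1.0003 * t ^ 2 + w)) by (field; lra).
replace (w / (1.0003 * t ^ 2 + w) * ((1.0003 + c) * (1.0003 * t ^ 2 + w)))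
  with (w * (1.0003 + c)) by (field; lra).
lra.
Qed.

Lemma integrand_middle (v : R) : 8 / 5 <= v -> t * v ^ 2 <= 1 ->
  - (scale ^ 2 / 2) * exp (- (1183 / 500)) * (v ^ 2 * exp (- (2737 / 1000 * (v - 8 / 5))))
    <= integrand (scale * v).
Proof.
intros Hv Htv. pose proof scale_pos as Hp. pose proof scale_sqr as Hs.
eapply Rle_trans; [| apply integrand_ge_opp].
set (th := scale * v).
assert (Hth2 : th ^ 2 = t ^ 2 * (t * v ^ 2)) by (unfold th; rewrite Rpow_mult_distr, Hs; ring).
assert (Ht2 : 0 < t ^ 2 <= 1 / 1024) by (split; [apply pow_lt; lra | nra]).
assert (Hv2 : 0 < v ^ 2) by (apply pow_lt; lra).
assert (Htv0 : 0 < t * v ^ 2) by nra.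
assert (Hth : 0 <= th) by (apply Rmult_le_pos; lra).
assert (Hle := one_sub_cos_le_half_sqr th).
assert (Hge : 0.49995 * th ^ 2 <= 1 - cos th) by (apply one_sub_cos_ge; [assumption | nra]).
assert (Hm := modulus_le t th N Ht truncation).
assert (Hg := gain_ge th (0.9999 * (t * v ^ 2)) ltac:(lra) ltac:(nra)).
assert (Hlin := exponent_ge_linear v Hv Htv).
(* 2.366 and 2.737 lie just below [0.999 * 2.37] and [0.999 * 2.74]; the first also pays for the
   [1 / 1000] of truncation and for [1 - cos th <= 1 / 2048]. *)
assert (Hm2 : modulus (exp (- t)) (seq 2 N) th <= exp (- (1183 / 500) + - (2737 / 1000 * (v - 8 / 5)))).
{ eapply Rle_trans; [apply Hm |]. apply exp_le_exp.
  assert (0.999 * (v ^ 2 / (1 + t * v ^ 2))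
    <= 1 / t * (0.9999 * (t * v ^ 2) / (1.0003 + 0.9999 * (t * v ^ 2)))); [| nra].
  replace (1 / t * (0.9999 * (t * v ^ 2) / (1.0003 + 0.9999 * (t * v ^ 2))))
    with (0.9999 * v ^ 2 / (1.0003 + 0.9999 * (t * v ^ 2))) by (field; lra).
  set (s := t * v ^ 2) in *.
  apply Rmult_le_reg_r with ((1 + s) * (1.0003 + 0.9999 * s)); [apply Rmult_lt_0_compat; lra |].
  replace (0.999 * (v ^ 2 / (1 + s)) * ((1 + s) * (1.0003 + 0.9999 * s)))
    with (v ^ 2 * (0.999 * (1.0003 + 0.9999 * s))) by (field; lra).
  replace (0.9999 * v ^ 2 / (1.0003 + 0.9999 * s) * ((1 + s) * (1.0003 + 0.9999 * s)))
    with (v ^ 2 * (0.9999 * (1 + s))) by (field; lra).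
  apply Rmult_le_compat_l; lra. }
rewrite exp_plus in Hm2.
replace (- (scale ^ 2 / 2) * exp (- (1183 / 500)) * (v ^ 2 * exp (- (2737 / 1000 * (v - 8 / 5)))))
  with (- (th ^ 2 / 2 * (exp (- (1183 / 500)) * exp (- (2737 / 1000 * (v - 8 / 5))))))
  by (rewrite Hth2, Hs; field).
apply Ropp_le_contravar.
apply Rmult_le_compat; [pose proof (COS_bound th); lra | apply Rlt_le, exp_pos | lra | lra].
Qed.

Lemma middle_integral : - (0.0688 * scale ^ 3) <= RInt integrand (scale * (8 / 5)) t.
Proof.
pose proof scale_pos as Hp. pose proof scale_sqr as Hs.
assert (Hr : 0 < sqrt t) by (apply sqrt_lt_R0; lra).
assert (Hrr : sqrt t * sqrt t = t) by (apply sqrt_sqrt; lra).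
assert (Hb : scale * (1 / sqrt t) = t) by (unfold scale; field; lra).
rewrite <- Hb at 1.
assert (Hr32 : sqrt t <= 1 / 5) by nra.
assert (Hb5 : 5 <= 1 / sqrt t).
{ apply Rmult_le_reg_r with (sqrt t); [assumption |].
  replace (1 / sqrt t * sqrt t) with 1 by (field; lra). lra. }
set (g := fun v : R => - (v ^ 2 / (2737 / 1000) + 2 * v / (2737 / 1000) ^ 2 + 2 / (2737 / 1000) ^ 3)
  * exp (- (2737 / 1000 * (v - 8 / 5)))).
assert (H := RInt_ge_of_derive integrand g (fun v => v ^ 2 * exp (- (2737 / 1000 * (v - 8 / 5))))
  scale (- (scale ^ 2 / 2) * exp (- (1183 / 500))) (8 / 5) (1 / sqrt t) Hp ltac:(lra) continuous_integrand).
eapply Rle_trans; [| apply H].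
- assert (HE : exp (- (1183 / 500)) <= 0.0941).
  { rewrite exp_Ropp.
    assert (10.63 <= exp (1183 / 500)).
    { replace (1183 / 500) with (INR 9 * (1 / 4) + 0.116) by (simpl INR; lra).
      rewrite exp_plus, exp_mul_INR.
      apply Rle_trans with (1.2838 ^ 9 * 1.1229); [lra |].
      apply Rmult_le_compat; [lra | lra | |].
      - apply pow_incr. pose proof (exp_ge_cubic (1 / 4) ltac:(lra)). lra.
      - pose proof (exp_ge_cubic 0.116 ltac:(lra)). lra. }
    apply Rle_trans with (/ 10.63); [apply Rinv_le_contravar; lra | lra]. }
  assert (Hg1 : g (1 / sqrt t) <= 0).
  { unfold g. set (w := 1 / sqrt t) in *. pose proof (exp_pos (- (2737 / 1000 * (w - 8 / 5)))).
    assert (0 <= w ^ 2 / (2737 / 1000) + 2 * w / (2737 / 1000) ^ 2 + 2 / (2737 / 1000) ^ 3) by nra. nra. }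
  assert (Hg0 : - 1.461 <= g (8 / 5)).
  { unfold g. replace (8 / 5 - 8 / 5) with 0 by ring. rewrite Rmult_0_r, Ropp_0, exp_0. lra. }
  assert (Hd : g (1 / sqrt t) - g (8 / 5) <= 1.461) by lra.
  assert (0 < scale ^ 3) by now apply pow_lt. pose proof (exp_pos (- (1183 / 500))).
  assert (exp (- (1183 / 500)) * (g (1 / sqrt t) - g (8 / 5)) <= 0.0941 * 1.461).
  { apply Rle_trans with (exp (- (1183 / 500)) * 1.461); [apply Rmult_le_compat_l; lra | lra]. }
  replace (scale * (- (scale ^ 2 / 2) * exp (- (1183 / 500))) * (g (1 / sqrt t) - g (8 / 5)))
    with (- (scale ^ 3 * (exp (- (1183 / 500)) * (g (1 / sqrt t) - g (8 / 5)) / 2))) by field.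
  apply Ropp_le_contravar. rewrite (Rmult_comm 0.0688). apply Rmult_le_compat_l; lra.
- intros v _. unfold g. auto_derive; [trivial |].
  change (v + - (8 / 5)) with (v - 8 / 5). field.
- intros v Hv. apply integrand_middle; [lra |].
  assert (v ^ 2 <= (1 / sqrt t) ^ 2) by (apply pow_incr; lra).
  replace ((1 / sqrt t) ^ 2) with (1 / t) in H0
    by (rewrite <- Hrr at 1; field; lra).
  replace 1 with (t * (1 / t)) by (field; lra). apply Rmult_le_compat_l; lra.
Qed.

Lemma RInt_integrand_ge_const (a b c : R) : a <= b ->
  (forall th, a <= th <= b -> - c <= integrand th) -> - (c * (b - a)) <= RInt integrand a b.
Proof.
intros Hab H.
assert (H1 := RInt_ge_of_derive integrand (fun v => v) (fun _ => 1) 1 (- c) a b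
  Rlt_0_1 Hab continuous_integrand).
rewrite !Rmult_1_l in H1. assert (- c * (b - a) <= RInt integrand a b); [apply H1 | lra].
- intros v _. auto_derive; trivial.
- intros v Hv. rewrite Rmult_1_l, Rmult_1_r. now apply H.
Qed.

(** Write [1 / t = 32 (1 + u)] with [u >= 0]; then [exp (32 c u) >= (1 + u) ^ k] as soon as
    [k <= 32 c]. This trades exponential smallness for the powers of [t] in which the arcs are
    compared. *)
Lemma exp_opp_div_le (c : R) (k : nat) : INR k <= 32 * c ->
  exp (- (c / t)) <= exp (- (32 * c)) * (32 * t) ^ k.
Proof.
intros Hc.
assert (Hu : 0 <= 1 / (32 * t) - 1).
{ assert (1 <= 1 / (32 * t)); [| lra]. apply Rmult_le_reg_r with (32 * t); [lra |].
  replace (1 / (32 * t) * (32 * t)) with 1 by (field; lra). lra. }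
set (u := 1 / (32 * t) - 1) in *.
assert (H1 : (1 + u) ^ k <= exp (32 * c * u)).
{ apply Rle_trans with (exp (INR k * u)).
  - rewrite exp_mul_INR. apply pow_incr. pose proof (exp_ineq1_le u). lra.
  - apply exp_le_exp, Rmult_le_compat_r; assumption. }
replace (1 + u) with (/ (32 * t)) in H1 by (unfold u; field; lra).
replace (- (c / t)) with (- (32 * c) + - (32 * c * u)) by (unfold u; field; lra).
rewrite exp_plus. apply Rmult_le_compat_l; [apply Rlt_le, exp_pos |].
rewrite exp_Ropp, <- (Rinv_inv ((32 * t) ^ k)), <- pow_inv.
apply Rinv_le_contravar; [| assumption].
apply pow_lt, Rinv_0_lt_compat. lra.
Qed.

(** Here [2 (1 - cos th) >= 0.9999 t ^ 2], so the gain is nearly [1 / (2 t)]; lowering it to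
    [15 / (32 t)] absorbs the corrections [1 - cos th + 1 / 1000]. *)
Lemma near_integral : - (0.003 * t ^ 5) <= RInt integrand t (3 * t).
Proof.
assert (Ht2 : 0 < t ^ 2 <= 1 / 1024) by (split; [apply pow_lt; lra | nra]).
assert (Ht5 : 0 < t ^ 5) by (apply pow_lt; lra).
assert (Hinv : 32 <= 1 / t).
{ apply Rmult_le_reg_r with t; [lra |]. replace (1 / t * t) with 1 by (field; lra). lra. }
eapply Rle_trans; [| apply (RInt_integrand_ge_const t (3 * t) (9 / 2 * t ^ 2 * exp (- (15 / 32 / t))))];
  [| lra |].
- apply Ropp_le_contravar.
  assert (H := exp_opp_div_le (15 / 32) 2 ltac:(simpl; lra)).
  assert (HE : exp (- (32 * (15 / 32))) <= / 3200000).
  { rewrite exp_Ropp. apply Rinv_le_contravar; [lra |].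
    replace (32 * (15 / 32)) with (INR 15 * 1) by (simpl; field). rewrite exp_mul_INR.
    apply Rle_trans with (2.716 ^ 15); [lra |]. apply pow_incr. pose proof exp_1_ge. lra. }
  assert (H2 : exp (- (15 / 32 / t)) <= / 3200000 * (32 * t) ^ 2).
  { eapply Rle_trans; [apply H |]. apply Rmult_le_compat_r; [apply pow2_ge_0 | assumption]. }
  assert (H3 : 9 * t ^ 3 * exp (- (15 / 32 / t)) <= 9 * t ^ 3 * (/ 3200000 * (32 * t) ^ 2)).
  { apply Rmult_le_compat_l; [| assumption]. assert (0 < t ^ 3) by (apply pow_lt; lra). lra. }
  replace (9 * t ^ 3 * (/ 3200000 * (32 * t) ^ 2)) with (9216 / 3200000 * t ^ 5) in H3 by field.
  lra.
- intros th Hth. eapply Rle_trans; [| apply integrand_ge_opp].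
  assert (Hth2 : th ^ 2 <= (3 * t) ^ 2) by (apply pow_incr; lra).
  assert (Hle := one_sub_cos_le_half_sqr th).
  assert (Hge : 0.49995 * t ^ 2 <= 1 - cos t) by (apply one_sub_cos_ge; lra).
  assert (Hpi := PI2_3_2).
  assert (Hdec : cos th <= cos t) by (apply cos_decr_1; lra).
  assert (Hm := modulus_le t th N Ht truncation).
  assert (Hg := gain_ge th 0.9999 ltac:(lra) ltac:(lra)).
  apply Ropp_le_contravar.
  apply Rmult_le_compat; [pose proof (COS_bound th); lra | apply Rlt_le, exp_pos | lra |].
  eapply Rle_trans; [apply Hm |]. apply exp_le_exp.
  replace (15 / 32 / t) with (15 / 32 * (1 / t)) by (field; lra). lra.
Qed.

(** Here [2 (1 - cos th) >= 8.99 t ^ 2], so the gain is nearly [0.9 / t]. The correction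
    [1 - cos th] is no longer small; it is paid for by [exp 2 <= 9], which with [1 - cos th <= 2]
    gives the constant 18. *)
Lemma far_integral : - (0.002 * t ^ 5) <= RInt integrand (3 * t) PI.
Proof.
assert (Ht2 : 0 < t ^ 2 <= 1 / 1024) by (split; [apply pow_lt; lra | nra]).
assert (Ht5 : 0 < t ^ 5) by (apply pow_lt; lra).
assert (Hinv : 32 <= 1 / t).
{ apply Rmult_le_reg_r with t; [lra |]. replace (1 / t * t) with 1 by (field; lra). lra. }
assert (Hpi := PI2_3_2). pose proof PI_4 as Hpi4.
eapply Rle_trans; [| apply (RInt_integrand_ge_const (3 * t) PI (18 * exp (- (28 / 32 / t))))];
  [| lra |].
- apply Ropp_le_contravar.
  assert (H := exp_opp_div_le (28 / 32) 5 ltac:(simpl; lra)).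
  assert (HE : exp (- (32 * (28 / 32))) <= / 1400000000000).
  { rewrite exp_Ropp. apply Rinv_le_contravar; [lra |].
    replace (32 * (28 / 32)) with (INR 28 * 1) by (simpl; field). rewrite exp_mul_INR.
    apply Rle_trans with (2.716 ^ 28); [lra |]. apply pow_incr. pose proof exp_1_ge. lra. }
  assert (H2 : exp (- (28 / 32 / t)) <= / 1400000000000 * (32 * t) ^ 5).
  { eapply Rle_trans; [apply H |]. apply Rmult_le_compat_r; [apply pow_le; lra | assumption]. }
  replace ((32 * t) ^ 5) with (33554432 * t ^ 5) in H2 by ring.
  pose proof (exp_pos (- (28 / 32 / t))).
  apply Rle_trans with (18 * exp (- (28 / 32 / t)) * 4); [apply Rmult_le_compat_l; lra | lra].
- intros th Hth. eapply Rle_trans; [| apply integrand_ge_opp].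
  assert (Hge : 0.4996 * (3 * t) ^ 2 <= 1 - cos (3 * t)) by (apply one_sub_cos_ge; lra).
  assert (Hdec : cos th <= cos (3 * t)) by (apply cos_decr_1; lra).
  assert (Hm := modulus_le t th N Ht truncation).
  assert (Hg := gain_ge th 8.99 ltac:(lra) ltac:(lra)).
  pose proof (COS_bound th).
  assert (He2 : exp 2 <= 9).
  { replace 2 with (INR 2 * 1) by (simpl; ring). rewrite exp_mul_INR.
    apply Rle_trans with (3 ^ 2); [apply pow_incr; split; [apply Rlt_le, exp_pos | apply exp_le_3] | lra]. }
  apply Ropp_le_contravar.
  replace (18 * exp (- (28 / 32 / t))) with (2 * (9 * exp (- (28 / 32 / t)))) by ring.
  apply Rmult_le_compat; [lra | apply Rlt_le, exp_pos | lra |].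
  apply Rle_trans with (exp (2 + - (28 / 32 / t))).
  + eapply Rle_trans; [apply Hm |]. apply exp_le_exp.
    replace (28 / 32 / t) with (28 / 32 * (1 / t)) by (field; lra). lra.
  + rewrite exp_plus. apply Rmult_le_compat_r; [apply Rlt_le, exp_pos | assumption].
Qed.

(** Since [t ^ 5 <= t ^ (9/2) = scale ^ 3], it suffices that [0.084 > 0.0688 + 0.003 + 0.002]. *)
Lemma RInt_integrand_pos : 0 < RInt integrand 0 PI.
Proof.
pose proof scale_pos as Hp. pose proof scale_sqr as Hs.
assert (Hex : forall a b, ex_RInt integrand a b)
  by (intros; apply (@ex_RInt_continuous R_CompleteNormedModule); intros; apply continuous_integrand).
assert (HC : forall a b c, RInt integrand a c = RInt integrand a b + RInt integrand b c)
  by (intros a b c; symmetry; apply (RInt_Chasles (V := R_CompleteNormedModule)); apply Hex).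
pose proof central_integral as H1. pose proof middle_integral as H2.
pose proof near_integral as H3. pose proof far_integral as H4.
rewrite Rmult_0_r in H1.
rewrite (HC 0 (scale * (8 / 5)) PI), (HC (scale * (8 / 5)) t PI), (HC t (3 * t) PI).
assert (Hr : 0 < sqrt t) by (apply sqrt_lt_R0; lra).
assert (Hrr : sqrt t * sqrt t = t) by (apply sqrt_sqrt; lra).
assert (Ht5 : t ^ 5 <= scale ^ 3).
{ replace (scale ^ 3) with (scale ^ 2 * scale) by ring. rewrite Hs. unfold scale.
  replace (t ^ 5) with (t ^ 3 * (t * t)) by ring.
  apply Rmult_le_compat_l; [apply pow_le; lra |]. apply Rmult_le_compat_l; [lra | nra]. }
assert (0 < scale ^ 3) by now apply pow_lt.
lra.
Qed.

End Saddle.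

(** * Large arguments *)

(** At [x1 = sqrt (n / (n + 2))] the term [k = 2] alone equals [n], and [k = 3] makes the sum exceed
    it, so the intermediate value theorem applies on [[0, x1]]. The bound [x1] is independent of
    [N]. *)
Lemma exists_saddle (n N : nat) : (1 <= n)%nat -> (2 <= N)%nat ->
  exists t, 0 < t /\ exp (- t) <= sqrt (INR n / (INR n + 2)) /\
    lsum (fun k => INR k * (exp (- t) ^ k / (1 - exp (- t) ^ k))) (seq 2 N) = INR n.
Proof.
intros Hn HN.
assert (Hn0 : 0 < INR n) by (apply lt_0_INR; lia).
set (x1 := sqrt (INR n / (INR n + 2))).
assert (Hq : 0 < INR n / (INR n + 2) < 1).
{ split; [apply Rdiv_lt_0_compat; lra |]. apply Rmult_lt_reg_r with (INR n + 2); [lra |].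
  replace (INR n / (INR n + 2) * (INR n + 2)) with (INR n) by (field; lra). lra. }
assert (Hx1 : 0 < x1 < 1).
{ split; [now apply sqrt_lt_R0 |]. unfold x1. rewrite <- sqrt_1. apply sqrt_lt_1; lra. }
assert (Hx1sq : x1 ^ 2 = INR n / (INR n + 2)) by (apply pow2_sqrt; lra).
set (f := fun x => lsum (fun k => INR k * (x ^ k / (1 - x ^ k))) (seq 2 N)).
assert (Hpow : forall x k, 0 <= x <= x1 -> (1 <= k)%nat -> 0 <= x ^ k < 1).
{ intros x k Hx Hk. split; [apply pow_le; lra |].
  apply Rle_lt_trans with (x1 ^ k); [apply pow_incr; lra | apply pow_lt_1; assumption]. }
destruct (IVT_interv (fun x => f x - INR n) 0 x1) as [x [Hx Hfx]].
- intros x Hx. apply continuity_pt_filterlim.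
  apply (continuous_minus f (fun _ => INR n)); [| apply continuous_const].
  apply (continuous_lsum (fun k u => INR k * (u ^ k / (1 - u ^ k)))). intros k Hk.
  pose proof (Hpow x k Hx (In_seq2_ge1 N k Hk)) as Hy.
  apply (ex_derive_continuous (fun u => INR k * (u ^ k / (1 - u ^ k)))). auto_derive. lra.
- lra.
- unfold f. rewrite (lsum_ext _ (fun k => 0 * 1)).
  + rewrite lsum_scal. lra.
  + intros k Hk. rewrite pow_i by (apply in_seq in Hk; lia). field.
- unfold f. destruct N as [| [| N]]; [lia | lia |]. cbn [seq lsum].
  assert (0 <= lsum (fun k => INR k * (x1 ^ k / (1 - x1 ^ k))) (seq 4 N)).
  { apply lsum_nonneg. intros k Hk. apply in_seq in Hk. apply Rmult_le_pos; [apply pos_INR |].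
    pose proof (Hpow x1 k ltac:(lra) ltac:(lia)). apply Rdiv_le_0_compat; lra. }
  assert (0 < INR 3 * (x1 ^ 3 / (1 - x1 ^ 3))).
  { pose proof (pow_lt_1 x1 3 Hx1 ltac:(lia)).
    apply Rmult_lt_0_compat; [simpl; lra | apply Rdiv_lt_0_compat; lra]. }
  assert (INR 2 * (x1 ^ 2 / (1 - x1 ^ 2)) = INR n)
    by (rewrite Hx1sq; simpl (INR 2); field; lra).
  lra.
- assert (Hx0 : 0 < x).
  { destruct (Req_dec x 0) as [Hx0 | ]; [| lra]. exfalso. rewrite Hx0 in Hfx. unfold f in Hfx.
    rewrite (lsum_ext _ (fun k => 0 * 1)), lsum_scal in Hfx; [lra |].
    intros k Hk. rewrite pow_i by (apply in_seq in Hk; lia). field. }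
  exists (- ln x). rewrite Ropp_involutive, exp_ln by assumption.
  split; [| split; [lra | unfold f in Hfx; lra]].
  assert (ln x < ln 1) by (apply ln_increasing; lra). rewrite ln_1 in H. lra.
Qed.

(** The estimate is uniform on [(0, x1]] because the saddle point is located only after [N] has been
    fixed. *)
Lemma exists_truncation (x1 : R) (n : nat) : 0 < x1 < 1 ->
  exists N, (n <= N)%nat /\ forall x, 0 < x <= x1 ->
    3 * x ^ (2 + N) / (1 - x) ^ 2 <= 1 / 1000.
Proof.
intros Hx1.
assert (H2 : 0 < (1 - x1) ^ 2) by (apply pow_lt; lra).
assert (He : 0 < (1 - x1) ^ 2 / 3000) by lra.
destruct (pow_lt_1_zero x1 ltac:(rewrite Rabs_pos_eq; lra) _ He) as [M HM].
exists (M + n)%nat. split; [lia |]. intros x Hx.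
specialize (HM (2 + (M + n))%nat ltac:(lia)).
rewrite Rabs_pos_eq in HM by (apply pow_le; lra).
assert (x ^ (2 + (M + n)) <= x1 ^ (2 + (M + n))) by (apply pow_incr; lra).
assert ((1 - x1) ^ 2 <= (1 - x) ^ 2) by (apply pow_incr; lra).
apply Rmult_le_reg_r with ((1 - x) ^ 2); [lra |].
replace (3 * x ^ (2 + (M + n)) / (1 - x) ^ 2 * (1 - x) ^ 2) with (3 * x ^ (2 + (M + n)))
  by (field; lra).
lra.
Qed.

Lemma parts_count_log_concave_large (n : nat) : (1690 <= n)%nat ->
  exists N, (n <= N)%nat /\
  (parts_count (seq 2 N) (n - 1) * parts_count (seq 2 N) (n + 1)
     < parts_count (seq 2 N) n * parts_count (seq 2 N) n)%nat.
Proof.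
intros Hn.
assert (Hn0 : 1690 <= INR n).
{ replace 1690 with (INR 1690) by (rewrite INR_IZR_INZ; reflexivity). now apply le_INR. }
assert (Hx1 : 0 < sqrt (INR n / (INR n + 2)) < 1).
{ assert (0 < INR n / (INR n + 2)) by (apply Rdiv_lt_0_compat; lra).
  split; [now apply sqrt_lt_R0 |]. rewrite <- sqrt_1. apply sqrt_lt_1; [lra | lra |].
  apply Rmult_lt_reg_r with (INR n + 2); [lra |].
  replace (INR n / (INR n + 2) * (INR n + 2)) with (INR n) by (field; lra). lra. }
destruct (exists_truncation _ n Hx1) as [N [HN Htrunc]].
destruct (exists_saddle n N ltac:(lia) ltac:(lia)) as [t [Ht [Htx Hsaddle]]].
(* [33 / 20 * 32 ^ 2 = 1689.6], which is where 1690 comes from. *)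
assert (Ht32 : t <= 1 / 32).
{ pose proof (mean_le t N Ht) as Hmean. rewrite Hsaddle in Hmean.
  assert (Ht2 : 0 < t ^ 2) by (apply pow_lt; lra).
  assert (INR n * t ^ 2 <= 33 / 20).
  { apply Rmult_le_compat_r with (r := t ^ 2) in Hmean; [| lra].
    replace (33 / 20 / t ^ 2 * t ^ 2) with (33 / 20) in Hmean by (field; lra). lra. }
  nra. }
exists N. split; [assumption |].
pose proof (exp_opp_lt_1 t Ht).
apply (log_concave_of_integral_pos (exp (- t))); [assumption | apply In_seq2_ge1 | lia |].
apply RInt_integrand_pos; [lra | assumption |].
apply Htrunc. lra.
Qed.

Local Close Scope R_scope.

(** * Small arguments *)

Lemma parts_count_app_large (ks js : list nat) (n : nat) :
  (forall k, In k ks -> 1 <= k) -> (forall j, In j js -> n < j) ->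
  parts_count (ks ++ js) n = parts_count ks n.
Proof.
revert n. induction ks as [| k ks IH]; intros n Hks Hjs.
- induction js as [| j js IHj]; [reflexivity |].
  assert (n < j) by (apply Hjs; now left).
  simpl app. rewrite parts_count_cons by lia.
  rewrite (proj2 (Nat.leb_gt j n)) by assumption. rewrite Nat.add_0_r.
  apply IHj. intros; apply Hjs; now right.
- assert (1 <= k) by (apply Hks; now left). revert Hjs.
  induction n as [n IHn] using lt_wf_ind. intros Hjs.
  simpl app. rewrite (parts_count_cons k (ks ++ js) n), (parts_count_cons k ks n) by assumption.
  f_equal.
  + apply IH; [intros; apply Hks; now right | assumption].
  + destruct (Nat.leb_spec k n); [| reflexivity].
    apply IHn; [lia |]. intros j Hj. specialize (Hjs j Hj). lia.
Qed.

Lemma parts_count_seq_stable (s M N n : nat) : 1 <= s -> M <= N -> n < s + M ->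
  parts_count (seq s N) n = parts_count (seq s M) n.
Proof.
intros Hs HMN Hn. replace N with (M + (N - M)) by lia. rewrite seq_app.
apply parts_count_app_large; intros k Hk; apply in_seq in Hk; lia.
Qed.

(* One pass over the table adds a new part [k]: [front ++ rev back] is a queue holding the [k] most
   recently computed entries, the oldest of which is added to the next entry. *)
Fixpoint add_part (front back row : list N) : list N :=
  match row with
  | nil => nil
  | r :: row' =>
      match front with
      | f :: front' => let s := N.add r f in s :: add_part front' (s :: back) row'
      | nil =>
          match rev' back with
          | nil => nil
          | f :: front' => let s := N.add r f in s :: add_part front' (s :: nil) row'
          end
      end
  end.

(* Adding the large parts first keeps most of the intermediate numbers small. *)
Fixpoint count_table (L s M : nat) : list N :=
  match M with
  | O => 1%N :: repeat 0%N (pred L)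
  | S M' => add_part (repeat 0%N s) nil (count_table L (S s) M')
  end.

Lemma add_part_spec (ks : list nat) (k : nat) : 1 <= k ->
  let G j := N.of_nat (parts_count (k :: ks) j) in
  let h j := if j <? k then 0%N else G (j - k) in
  forall m i front back, front ++ rev back = map h (seq i k) ->
  add_part front back (map (fun j => N.of_nat (parts_count ks j)) (seq i m)) = map G (seq i m).
Proof.
intros Hk G h.
assert (HG : forall i, G i = (N.of_nat (parts_count ks i) + h i)%N).
{ intros i. unfold G at 1. rewrite parts_count_cons by assumption. rewrite Nat2N.inj_add. f_equal.
  unfold h. rewrite Nat.ltb_antisym. now destruct (k <=? i). }
assert (Hqueue : forall i, map h (seq i k) = h i :: map h (seq (S i) (k - 1)))
  by (intros i; destruct k; [lia |]; simpl; now rewrite Nat.sub_0_r).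
assert (Hnext : forall i, map h (seq (S i) k) = map h (seq (S i) (k - 1)) ++ G i :: nil).
{ intros i. replace k with (S (k - 1)) at 1 by lia. rewrite seq_S, map_app. simpl. do 2 f_equal.
  unfold h. rewrite (proj2 (Nat.ltb_ge _ _)) by lia. f_equal. lia. }
induction m as [| m IH]; intros i front back Hq; [reflexivity |].
rewrite Hqueue in Hq. cbn [seq map add_part].
destruct front as [| f front].
- unfold rev'. rewrite <- rev_alt. simpl in Hq. rewrite Hq.
  rewrite <- HG. f_equal. apply IH. now rewrite Hnext.
- simpl in Hq. injection Hq as -> Hq. rewrite <- HG. f_equal. apply IH.
  rewrite Hnext, <- Hq. simpl. now rewrite app_assoc.
Qed.

Lemma count_table_spec (L s M : nat) : 1 <= L -> 1 <= s ->
  count_table L s M = map (fun n => N.of_nat (parts_count (seq s M) n)) (seq 0 L).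
Proof.
intros HL. revert s. induction M as [| M IH]; intros s Hs.
- destruct L as [| L]; [lia |]. cbn [count_table seq map pred]. f_equal.
  assert (Hz : forall a, 1 <= a -> map (fun n => N.of_nat (parts_count nil n)) (seq a L) = repeat 0%N L).
  { induction L as [| L IHL]; intros a Ha; [reflexivity |].
    destruct a as [| a]; [lia |]. cbn [seq map repeat]. f_equal.
    destruct L; [reflexivity |]. apply IHL; lia. }
  now rewrite Hz.
- cbn [count_table seq]. rewrite IH by lia.
  apply add_part_spec; [assumption |]. simpl rev. rewrite app_nil_r.
  assert (Hz : forall b a, a + b <= s ->
    repeat 0%N b = map (fun j => if j <? s then 0%N
      else N.of_nat (parts_count (s :: seq (S s) M) (j - s))) (seq a b)).
  { induction b as [| b IHb]; intros a Hab; [reflexivity |]. cbn [seq map repeat].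
    rewrite (proj2 (Nat.ltb_lt a s)) by lia. f_equal. apply IHb. lia. }
  apply Hz. lia.
Qed.

Fixpoint log_concave_list (l : list N) : bool :=
  match l with
  | a :: ((b :: c :: _) as l') => (a * c <? b * b)%N && log_concave_list l'
  | _ => true
  end.

Lemma log_concave_list_spec (f : nat -> N) (m i : nat) :
  log_concave_list (map f (seq i (2 + m))) = true ->
  forall j, i <= j < i + m -> (f j * f (S (S j)) < f (S j) * f (S j))%N.
Proof.
revert i. induction m as [| m IH]; intros i H j Hj; [lia |].
change (seq i (2 + S m)) with (i :: S i :: S (S i) :: seq (S (S (S i))) m) in H.
cbn [map log_concave_list] in H.
apply Bool.andb_true_iff in H. destruct H as [H1 H2].
destruct (Nat.eq_dec i j) as [<- | Hne]; [now apply N.ltb_lt |].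
apply (IH (S i)); [exact H2 | lia].
Qed.

Lemma count_table_log_concave (L M i n : nat) : 1 <= L ->
  log_concave_list (skipn i (count_table L 2 M)) = true -> i < n -> n + 1 < L ->
  parts_count (seq 2 M) (n - 1) * parts_count (seq 2 M) (n + 1)
    < parts_count (seq 2 M) n * parts_count (seq 2 M) n.
Proof.
intros HL H Hi Hn.
rewrite count_table_spec, skipn_map, skipn_seq in H by lia.
replace (L - i) with (2 + (L - i - 2)) in H by lia.
assert (H1 := log_concave_list_spec _ _ _ H (n - 1) ltac:(lia)).
cbv beta in H1. replace (S (S (n - 1))) with (n + 1) in H1 by lia.
replace (S (n - 1)) with n in H1 by lia. lia.
Qed.

(** The table covers the indices 0 to 1690 with parts 2 to 1690. Skipping 71 entries makes 72 the
    first middle index, which is [n + 1] for [n = 71]; the last is 1689. *)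
Lemma log_concave_table : log_concave_list (skipn 71 (count_table 1691 2 1689)) = true.
Proof. vm_cast_no_check (eq_refl true). Qed.

Lemma parts_count_log_concave_small (n : nat) : 71 < n -> n + 1 < 1691 ->
  parts_count (seq 2 1689) (n - 1) * parts_count (seq 2 1689) (n + 1)
    < parts_count (seq 2 1689) n * parts_count (seq 2 1689) n.
Proof.
exact (count_table_log_concave 1691 1689 71 n (le_n_S _ _ (Nat.le_0_l _)) log_concave_table).
Qed.

(** * Partitions as sequences *)

From mathcomp Require Import all_boot all_order all_algebra.
From mathcomp Require Import zify.
Local Open Scope ring_scope.

Lemma parts_count_consE (k : nat) (ks : seq nat) (n : nat) : (0 < k)%N ->
  parts_count (k :: ks) n
    = (parts_count ks n + if (k <= n)%N then parts_count (k :: ks) (n - k) else 0)%N.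
Proof.
move=> k_gt0; rewrite parts_count_cons; last exact/leP.
by case: leqP => [/leP/PeanoNat.Nat.leb_le -> | /ltP/PeanoNat.Nat.leb_gt ->].
Qed.

(* Partitions are listed here with their parts in nondecreasing order, the smallest part first. *)
Lemma parts_count_correct (s N n : nat) : (0 < s)%N ->
  exists2 L : seq (seq nat), uniq L &
    (forall u, (u \in L) = [&& sorted leq u, all (fun k => s <= k < s + N)%N u & sumn u == n])
    /\ size L = parts_count (iota s N) n.
Proof.
elim: N s n => [|N IHN] s n s_gt0.
  exists (if n == 0%N then [:: [::]] else [::]); first by case: ifP.
  split; last by case: n.
  move=> u; case: u => [|k u] /=; first by rewrite eq_sym; case: eqP.
  have -> : (s <= k < s + 0)%N = false by lia.
  by rewrite andbF; case: ifP.
elim/ltn_ind: n => n IHn.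
have [L1 uniqL1 [memL1 sizeL1]] := IHN s.+1 n isT.
(* [L1] collects the lists without the part [s]. A list containing [s], its least possible part,
   begins with it, so the others are [cons s] of the lists for [n - s], as in [parts_count_cons]. *)
have mem1 u : (u \in L1) = [&& [&& sorted leq u, all (fun k => s <= k < s + N.+1)%N u
                              & sumn u == n] & s \notin u].
  have all_split : all (fun k => s.+1 <= k < s.+1 + N)%N u
      = all (fun k => s <= k < s + N.+1)%N u && (s \notin u).
    rewrite -has_pred1 -all_predC -all_predI; apply: eq_all => k /=; lia.
  by rewrite memL1 all_split -!andbA; do 2 congr andb; rewrite andbC.
have [s_le_n | n_lt_s] := leqP s n; last first.
  exists L1 => //; split; last by rewrite sizeL1 [RHS]parts_count_consE // leqNgt n_lt_s addn0.
  move=> u; rewrite mem1 andb_idr // => /and3P[_ _ /eqP sum_u].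
  apply/negP => s_in_u; move: n_lt_s; rewrite -sum_u ltnNge; case/negP.
  elim: u s_in_u {sum_u} => //= k u IHu; rewrite inE => /predU1P[-> | /IHu]; lia.
have [L2 uniqL2 [memL2 sizeL2]] := IHn (n - s)%N ltac:(lia).
exists (L1 ++ map (cons s) L2).
  rewrite cat_uniq uniqL1 map_inj_uniq ?uniqL2 ?andbT /=; last by move=> u v [].
  by apply/hasPn => _ /mapP[u _ ->]; apply/negP; rewrite mem1 inE eqxx andbF.
split; last by rewrite size_cat size_map sizeL1 sizeL2 [RHS]parts_count_consE // s_le_n.
move=> u; rewrite mem_cat mem1; case: (boolP (s \in u)) => [s_in_u | s_notin_u]; last first.
  rewrite andbT orbC; case: mapP => //= [[v _ def_u]].
  by rewrite def_u inE eqxx in s_notin_u.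
rewrite andbF /=; case: u s_in_u => //= k u s_in_ku.
apply/mapP/and3P => [[v v_L2 [-> ->]] | [sorted_u /andP[k_bounds all_u] /eqP sum_u]].
  move: v_L2; rewrite memL2 => /and3P[sorted_v all_v /eqP sum_v]; split.
  - rewrite (path_sortedE leq_trans) sorted_v andbT.
    by apply: sub_all all_v => j; case/andP.
  - by rewrite all_v andbT; lia.
  - by rewrite sum_v subnKC.
have [le_k_u sorted_u'] : all (leq k) u /\ sorted leq u.
  by apply/andP; rewrite -(path_sortedE leq_trans).
have k_eq : k = s.
  apply/eqP; rewrite eqn_leq (andP k_bounds).1 andbT.
  by move: s_in_ku; rewrite inE => /predU1P[<- // | /(allP le_k_u)].
exists u; last by rewrite k_eq.
by rewrite memL2 sorted_u' all_u /= -sum_u k_eq addKn.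
Qed.

(** Reversal exchanges nonincreasing and nondecreasing lists, and the bound of the parts by [n]
    follows from their sum. *)
Lemma npartitionsE (n : nat) : npartitions n = parts_count (List.seq 1 n) n.
Proof.
have [L uniqL [memL <-]] := npartitions_spec n.
have [L' uniqL' [memL' sizeL']] := parts_count_correct 1 n n isT.
rewrite -[RHS]sizeL' -(size_map rev L').
apply/eqP; rewrite -uniq_size_uniq //.
  by rewrite map_inj_uniq //; exact: (can_inj revK).
move=> u; rewrite memL -[RHS]/(is_partition n u) -[u in LHS]revK mem_map ?memL'; last exact: (can_inj revK).
rewrite rev_sorted all_rev sumn_rev /is_partition; congr andb.
case: (boolP (sumn u == n)) => [sum_u | _]; last by rewrite !andbF.
rewrite !andbT; apply/idP/idP => /allP H; apply/allP => k k_u; first by case/andP: (H k k_u).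
rewrite H //= add1n ltnS -(eqP sum_u).
elim: u k_u {sum_u H} => //= j u IHu; rewrite inE => /predU1P[-> | /IHu]; lia.
Qed.

(** Removing one part 1 is a bijection from the partitions of [n + 1] containing 1 to those of [n].
    Both counts are first taken over the common list of parts 1 to [n + 2]. *)
Lemma npartitions_diff (n : nat) :
  fdiff pZ n = (parts_count (List.seq 2 n.+1) n.+1)%:Z.
Proof.
rewrite /fdiff /pZ !npartitionsE.
rewrite -(parts_count_seq_stable 1 n n.+2 n); [|lia|lia|lia].
rewrite -(parts_count_seq_stable 1 n.+1 n.+2 n.+1); [|lia|lia|lia].
rewrite -[List.seq 1 n.+2]/(1%N :: List.seq 2 n.+1) (parts_count_consE 1 _ n.+1) //.
by rewrite subSS subn0 PoszD GRing.addrK.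
Qed.

Theorem theorem2p1 (n : nat) (hn : (71 <= n)%N) :
  (fdiff pZ n) ^+ 2 > fdiff pZ (n - 1)%N * fdiff pZ (n + 1)%N.
Proof.
have [N [n_le_N logc]] : exists N, (n.+1 <= N)%coq_nat /\
  (parts_count (List.seq 2 N) (n.+1 - 1) * parts_count (List.seq 2 N) (n.+1 + 1)
     < parts_count (List.seq 2 N) n.+1 * parts_count (List.seq 2 N) n.+1)%coq_nat.
  have [n_small | n_large] := ltnP n.+2 1691.
    by exists 1689%N; split; [lia | apply: parts_count_log_concave_small; lia].
  by apply: parts_count_log_concave_large; lia.
rewrite !npartitions_diff.
(* Parts larger than [m] do not affect the count at [m], and [N >= n + 1] allows parts up to at
   least [n + 2], so one list serves all three indices. *)
have stable m : (0 < m)%N -> (m <= n.+2)%N ->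
    parts_count (List.seq 2 m) m = parts_count (List.seq 2 N) m.
  move=> m_gt0 m_le; case: (leqP m N) => mN.
    by rewrite [RHS](parts_count_seq_stable 2 m); lia.
  by rewrite (parts_count_seq_stable 2 N); lia.
rewrite !stable ?subn1 ?addn1 //; try lia.
have -> : (n.-1.+1 = n.+1 - 1)%N by lia.
have -> : (n.+2 = n.+1 + 1)%N by lia.
by rewrite GRing.expr2 -!PoszM ltz_nat; lia.
Qed.
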